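(* Let $m,n\ge1$. For $1\le i\le\min(m,n)+1$ with $i\le n$, let $\nu^i=((n-i+1)^{m-i+1})$ be the rectangle with $m-i+1$ rows of length $n-i+1$. Then $$\Delta_{[i,n],[1,n-i+1]}\bigl(\widehat{M}'(t)\bigr)=\sum_{d=0}^{\max(0,\,m-2i+2)}\bigl((-1)^{n-i}t\bigr)^d\, cs^{(n)}_{R^d(\nu^i);\,n-i+1}(\mathbf{x}_1,\dots,\mathbf{x}_m).$$
   Context: $[a,b]=\{k\in\mathbb{Z}:a\le k\le b\}$. The $x_i^j$ ($i\in[1,m]$, $j\in[1,n]$) are independent indeterminates over $\mathbb{C}$; for $r\in\mathbb{Z}$ put $x_i^{(r)}=x_i^j$ where $j\in[1,n]$, $j\equiv r-i+1\pmod n$. $\mathbf{x}_i=(x_i^1,\dots,x_i^n)$. A cell $s$ in row $a$, column $b$ has content $c(s)=a-b$. Loop skew Schur function: $s^{(r)}_{\lambda/\mu}=\sum_T\prod_{s\in\lambda/\mu}x_{T(s)}^{(c(s)+r)}$ over semistandard Young tableaux $T$ of shape $\lambda/\mu$ with entries in $[1,m]$ (rows weakly, columns strictly increasing; English notation); it equals $1$ if $\lambda=\mu$. Shape invariants: for $1\le k\le p:=\min(m,n)$, $S_k=s^{(n)}_{((n-k+1)^{m-k+1})}$; $S_{p+1}=1$. Reduced $Q$-invariants: for $i\in[1,m]$, $j\in[1,n]$, $i+j\le m$, let $0\le K\le n-1$ with $K\equiv i+j-m-1\pmod n$, $\lambda_i^j=((n-j+K+1)^{m-n+K},(n-j)^{m-i-j})$,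 $\mu_i^j=((n-j+1)^{m-n+K-i})$ (exponents are multiplicities), and $\widetilde{Q}_i^{(j)}=s^{(n-j+1)}_{\lambda_i^j/\mu_i^j}/(S_{j+1}S_{n+1-K})$. Also $\widetilde{Q}_0^{(j)}=1$, $\widetilde{Q}_k^{(j)}=0$ for $k<0$. $\widehat{M}'(t)$ is the $n\times n$ matrix with $\widehat{M}'(t)_{ij}=M'_{ij}+\sum_{d>0}t^d\,\widetilde{Q}^{(i)}_{m+j-i-nd}$, where $M'_{ij}=(-1)^{n-i}S_i/S_{i+1}$ if $i\le m$ and $i+j=n+1$; $M'_{ij}=1$ if $i-j=m$; $M'_{ij}=0$ otherwise. $\Delta_{A,B}$ denotes the minor with rows $A$ and columns $B$. Cylindric loop Schur functions. Fix $k\in[1,n]$. A partition $\lambda$ is $k$-cylindric if $\lambda_1\le k$ and $\lambda'_1-\lambda'_k\le n-k$ ($\lambda'$ the conjugate). For such $\lambda$, $\widetilde\lambda$ is the union of all translates of the Young diagram of $\lambda$ by integer multiples of $(-n+k,k)$ (matrix coordinates: $n-k$ rows up, $k$ columns right). For $k$-cylindric $\mu\subseteq\lambda$, $\widetilde\lambda/\widetilde\mu$ is the corresponding infinite skew shape, i.e. the union of all these translates of $\lambda/\mu$; a partition $\lambda$ is identified with $\lambda/\emptyset$. A semistandard filling $T$ of $\lambda/\mu$ is a $k$-cylindric tableau if placing $T$ in each translate gives a filling of $\widetilde\lambda/\widetilde\mu$ with weakly increasing rows and strictly increasing columns. $cs^{(r)}_{\lambda/\mu;k}(\mathbf{x}_1,\dots,\mathbf{x}_m)=\sum_T\prod_{s\in\lambda/\mu}x_{T(s)}^{(c(s)+r)}$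 over $k$-cylindric tableaux of shape $\lambda/\mu$ with entries in $[1,m]$ (equal to $1$ for the empty shape). Removal operation. If $\lambda$ is $k$-cylindric with $\lambda'_1\ge n-k+1$, $\lambda^\flat$ is the $k$-cylindric partition with conjugate $(\lambda'_2-1,\dots,\lambda'_k-1,\lambda'_1-n+k-1)$; otherwise undefined. $R(\lambda/\mu)=\lambda^\flat/\mu$ if $\lambda^\flat$ is defined and contains $\mu$, otherwise undefined. $R^d$ is the $d$-fold iterate of $R$. In the claim $R$ is taken with $k=n-i+1$.
   Formalization: Terms of the sum for which R^d(ν^i) is undefined (for example n=2, i=2, m=4, d=2, where R(ν^i)=(1) admits no further removal) are taken to be 0; the statement as written assigns them no value. *)

(* Defs.v *)
From HB Require Import structures.
From mathcomp Require Import all_boot all_order all_algebra.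
From mathcomp Require Import boolp reals.
From mathcomp Require Import complex mpoly.

Set Implicit Arguments.
Unset Strict Implicit.
Unset Printing Implicit Defensive.

Import Order.TTheory GRing.Theory Num.Theory.

Local Open Scope ring_scope.

(* A partition is a weakly decreasing [seq nat]; trailing zeros are allowed and
   harmless.  Rows, columns, and the cells (a, b) (row a, column b) are
   numbered from 1. *)

Definition part_row (lam : seq nat) (a : nat) : nat := nth 0%N lam a.-1.

(* lambda'_b *)
Definition part_col (lam : seq nat) (b : nat) : nat :=
  count (fun l => (b <= l)%N) lam.

Definition part_conj (lam : seq nat) : seq nat :=
  [seq part_col lam b | b <- iota 1 (part_row lam 1)].

Definition part_sub (mu lam : seq nat) : bool :=
  all (fun a => (part_row mu a <= part_row lam a)%N) (iota 1 (size mu)).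

(* A skew shape lambda/mu is encoded by the pair (lambda, mu). *)
Definition skew_shape : Type := (seq nat * seq nat)%type.

Definition skew_cells (sh : skew_shape) : seq (nat * nat) :=
  [seq (a, b) | a <- iota 1 (size sh.1),
                b <- iota (part_row sh.2 a).+1
                          (part_row sh.1 a - part_row sh.2 a)%N].

Notation cell sh := (seq_sub (skew_cells sh)).

Definition cell_row (sh : skew_shape) (s : cell sh) : nat := (val s).1.
Definition cell_col (sh : skew_shape) (s : cell sh) : nat := (val s).2.

Definition content (sh : skew_shape) (s : cell sh) : int :=
  (cell_row s)%:Z - (cell_col s)%:Z.

(* Fillings take values in 'I_m; v : 'I_m stands for the entry v + 1. *)
Notation filling sh m := {ffun cell sh -> 'I_m}.

Definition semistandard (sh : skew_shape) (m : nat) (T : filling sh m) : bool :=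
  [forall s : cell sh, forall s' : cell sh,
    ((cell_row s == cell_row s') && (cell_col s <= cell_col s')%N
       ==> (T s <= T s')%N) &&
    ((cell_col s == cell_col s') && (cell_row s < cell_row s')%N
       ==> (T s < T s')%N)].

(* The position of s in the translate of the shape by c * (- n + k, k). *)
Definition translate_row (n k : nat) (sh : skew_shape) (c : int) (s : cell sh)
  : int := (cell_row s)%:Z + c * (k%:Z - n%:Z).
Definition translate_col (k : nat) (sh : skew_shape) (c : int) (s : cell sh)
  : int := (cell_col s)%:Z + c * k%:Z.

Definition cylindric_tableau (n k : nat) (sh : skew_shape) (m : nat)
    (T : filling sh m) : Prop :=
  forall (c c' : int) (s s' : cell sh),
    (translate_row n k c s = translate_row n k c' s' ->
     translate_col k c s <= translate_col k c' s' -> (T s <= T s')%N) /\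
    (translate_col k c s = translate_col k c' s' ->
     translate_row n k c s < translate_row n k c' s' -> (T s < T s')%N).

Definition cylindric (n k : nat) (lam : seq nat) : bool :=
  [&& sorted geq lam, (part_row lam 1 <= k)%N &
      (part_col lam 1 - part_col lam k <= n - k)%N].

(* The natural-number subtractions below are exact: a k-cylindric lambda with
   lambda'_1 >= n - k + 1 has lambda'_b >= 1 for all b <= k. *)
Definition flat (n k : nat) (lam : seq nat) : option (seq nat) :=
  if cylindric n k lam && (n - k + 1 <= part_col lam 1)%N then
    Some (part_conj (rcons [seq (part_col lam b - 1)%N | b <- iota 2 (k - 1)%N]
                           (part_col lam 1 - (n - k + 1))%N))
  else None.

Definition removal (n k : nat) (sh : skew_shape) : option skew_shape :=
  if flat n k sh.1 is Some lam then
    if part_sub sh.2 lam then Some (lam, sh.2) else None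
  else None.

Definition removal_iter (n k d : nat) (sh : skew_shape) : option skew_shape :=
  iter d (obind (removal n k)) (Some sh).

Section LoopSchur.
Variables (F : fieldType) (m n : nat).
(* x i j stands for x_{i+1}^{j+1}. *)
Variable x : 'M[F]_(m, n).

(* x_{i+1}^{(r)}; for n > 0 there is exactly one such j. *)
Definition loop_var (i : 'I_m) (r : int) : F :=
  if [pick j : 'I_n | (j.+1%:Z == r - i.+1%:Z + 1 %[mod n%:Z])%Z] is Some j
  then x i j else 0.

Definition weight (r : int) (sh : skew_shape) (T : filling sh m) : F :=
  \prod_(s : cell sh) loop_var (T s) (content s + r).

Definition loop_schur (r : int) (sh : skew_shape) : F :=
  \sum_(T : filling sh m | semistandard T) weight r T.

Definition cyl_loop_schur (k : nat) (r : int) (sh : skew_shape) : F :=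
  \sum_(T : filling sh m | `[< cylindric_tableau n k T >]) weight r T.

(* An undefined shape contributes 0. *)
Definition cyl_loop_schur_opt (k : nat) (r : int) (osh : option skew_shape)
  : F := if osh is Some sh then cyl_loop_schur k r sh else 0.

(* Only used for 1 <= k <= min(m, n) + 1. *)
Definition shape_inv (k : nat) : F :=
  if (1 <= k <= minn m n)%N
  then loop_schur n%:Z (nseq (m - k + 1)%N (n - k + 1)%N, [::])
  else 1.

(* For i >= 1, 1 <= j <= n and i + j <= m one has m + K >= n + i, so the
   natural-number subtractions are exact. *)
Definition redQ_pos (i j : nat) : F :=
  let K := `|((((i + j)%N%:Z - m%:Z) - 1) %% n%:Z)%Z|%N in
  let lam := nseq (m + K - n)%N (n - j + K + 1)%N ++ nseq (m - i - j)%N (n - j)%N in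
  let mu := nseq (m + K - n - i)%N (n - j + 1)%N in
  loop_schur (n - j + 1)%N%:Z (lam, mu)
    / (shape_inv (j + 1)%N * shape_inv (n + 1 - K)%N).

(* redQ i j is the reduced Q-invariant with lower index i, upper index j. *)
Definition redQ (i : int) (j : nat) : F :=
  match i with
  | Posz 0 => 1
  | Posz i' => redQ_pos i' j
  | Negz _ => 0
  end.

Definition Mprime (i j : nat) : F :=
  if (i <= m)%N && (i + j == n + 1)%N then
    (-1) ^+ (n - i) * (shape_inv i / shape_inv (i + 1)%N)
  else if i == (m + j)%N then 1
  else 0.

(* The terms with d > m + n vanish: their lower index m + j - i - n d is
   negative. *)
Definition Mhat_entry (i j : nat) : {poly F} :=
  (Mprime i j)%:P +
  \sum_(1 <= d < (m + n).+1)
     redQ ((m + j)%N%:Z - i%:Z - (n * d)%N%:Z) i *: 'X^d.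

Definition Mhat : 'M[{poly F}]_n :=
  \matrix_(i < n, j < n) Mhat_entry i.+1 j.+1.

End LoopSchur.

(* For #|A| = #|B|: the enumerations of A and B are increasing, and the default
   value of nth is never reached. *)
Definition minor (R : comNzRingType) (n : nat) (A B : {set 'I_n}) (M : 'M[R]_n)
  : R :=
  \det (\matrix_(a < #|A|, b < #|A|)
          M (enum_val a) (nth (enum_val b) (enum B) b)).

(* C(x_i^j : i in [1, m], j in [1, n]), with C = R[i]. *)
Notation ratfun R m n := {fraction {mpoly R[i][m * n]}}.

Definition indets (R : realType) (m n : nat) : 'M[ratfun R m n]_(m, n) :=
  \matrix_(i < m, j < n)
    tofrac 'X_(mxvec_index i j).

(* Main.v *)
Require Import Defs.
From mathcomp Require Import all_boot all_order all_algebra all_fingroup.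
From mathcomp Require Import boolp reals.
From mathcomp Require Import complex mpoly.
From mathcomp Require Import zify ring.

(* Let M(t) be the product over v of the n x n whirl matrices with the x_v^b on
   the diagonal, 1 below it and t in the upper right corner.
   - Adding a scaled column and its neighbour expands a minor of M(t) into a sum
     over families of noncrossing paths on a cylinder: crossing terms have equal
     or proportional columns and vanish.  Recording which columns of a tableau
     contain the entry v turns such families into (cylindric) tableaux.  On a
     wide cylinder this is the Jacobi-Trudi formula for loop skew Schur
     functions.
   - Removal moves the first column index to the end and shifts it by n, which
     multiplies the minor by (-1)^(k-1) / t; so the coefficient of t^d is the
     constant coefficient for R^d(nu).
   - The matrix of the theorem is U M(t) V with U and V upper unitriangular over
     the base field: U and V perform the reduction of M(0) to its antidiagonal
     form, and the remaining entries are quotients of minors by bordered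
     determinants.  Minors with the last rows and the first columns do not see U
     and V. *)

Set Implicit Arguments.
Unset Strict Implicit.
Unset Printing Implicit Defensive.

Import Order.TTheory GRing.Theory Num.Theory.

Local Open Scope ring_scope.

(** * Minors of products of bidiagonal matrices *)

(** The expansion of the minor is signed: a family of k paths whose total winding is not a multiple
    of k ends in permuted order. Only in degree [G * k] is every path forced to wind exactly [G]
    times, in the original order and without a sign. The coefficient of t^d is therefore not read
    off in place: d rotations, together with a translation of all positions by [n * d], carry it to
    degree [d * k]. Rotations alone would leave the range of positions in which columns may be
    extended by powers of t. The reduced Q-invariants are quotients, so matching them with matrix
    entries requires nonzero shape invariants. This is the only place where the [x] have to be
    indeterminates; all else holds for any matrix over a field. *)

Fixpoint whirl (R : comNzRingType) (w : nat -> int -> R) (f : int -> R)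
    (v : nat) (b : int) : R :=
  if v is v'.+1 then w v' b * whirl w f v' b + whirl w f v' (b + 1) else f b.

(** For [0 < N] this says that the extension of [q] by [q (c + k) = q c - N] is strictly decreasing:
    [k] disjoint particles on a circle of length [N]. *)
Definition noncrossing (N k : nat) (q : 'I_k -> int) : bool :=
  [forall c : 'I_k, forall c' : 'I_k, (c < c')%N ==>
     (q c' < q c) && (q c < q c' + N%:Z)].

(* A tableau with entries in [1, m] is encoded by the sets [Y u] of columns
   containing the entry u+1.  Column c is the path starting at [q c] and moving
   one step up when it lacks the entries m, m-1, ..., in this order;
   [height_pos q Y v] is the configuration after the entries > v. *)
Definition height_pos (k m : nat) (q : 'I_k -> int)
    (Y : {ffun 'I_m -> {set 'I_k}}) (v : nat) (c : 'I_k) : int :=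
  q c + (\sum_(u < m | (v <= u)%N) (c \notin Y u))%N%:Z.

Definition chain (N k m : nat) (q : 'I_k -> int)
    (Y : {ffun 'I_m -> {set 'I_k}}) : bool :=
  [forall v : 'I_m.+1, noncrossing N (height_pos q Y v)].

Definition chain_weight (R : comNzRingType) (w : nat -> int -> R) (k m : nat)
    (q : 'I_k -> int) (Y : {ffun 'I_m -> {set 'I_k}}) : R :=
  \prod_(u < m) \prod_(c in Y u) w u (height_pos q Y u.+1 c).

Lemma noncrossingP (N k : nat) (q : 'I_k -> int) :
  reflect (forall c c' : 'I_k, (c < c')%N -> q c' < q c < q c' + N%:Z)
          (noncrossing N q).
Proof.
apply: (iffP forallP) => [H c c' lt|H c].
  by move/forallP: (H c) => /(_ c'); rewrite lt.
by apply/forallP => c'; apply/implyP; apply: H.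
Qed.

Lemma eq_noncrossing (N k : nat) (q q' : 'I_k -> int) :
  q =1 q' -> noncrossing N q = noncrossing N q'.
Proof.
by move=> e; apply: eq_forallb => c; apply: eq_forallb => c'; rewrite !e.
Qed.

Definition ffun_rcons (X : finType) (m : nat) (S : X) (Y : {ffun 'I_m -> X}) :
    {ffun 'I_m.+1 -> X} :=
  [ffun u => if unlift ord_max u is Some u' then Y u' else S].

Lemma ffun_rcons_max (X : finType) (m : nat) (S : X) (Y : {ffun 'I_m -> X}) :
  ffun_rcons S Y ord_max = S.
Proof. by rewrite ffunE unlift_none. Qed.

Lemma widen_ord_lift m (u : 'I_m) : widen_ord (leqnSn m) u = lift ord_max u.
Proof. by apply: val_inj; rewrite /= /bump leqNgt ltn_ord. Qed.

Lemma ffun_rcons_widen (X : finType) (m : nat) (S : X) (Y : {ffun 'I_m -> X}) u :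
  ffun_rcons S Y (widen_ord (leqnSn m) u) = Y u.
Proof. by rewrite widen_ord_lift ffunE liftK. Qed.

Lemma big_ffun_recr (R : nmodType) (X : finType) (m : nat)
    (G : {ffun 'I_m.+1 -> X} -> R) :
  \sum_Y G Y = \sum_S \sum_Y G (ffun_rcons S Y).
Proof.
rewrite pair_big /= (reindex (fun p : X * {ffun 'I_m -> X} => ffun_rcons p.1 p.2)) //=.
exists (fun Y : {ffun 'I_m.+1 -> X} =>
          (Y ord_max, [ffun u => Y (widen_ord (leqnSn m) u)])).
  move=> [S Y] _ /=; rewrite ffun_rcons_max; congr pair.
  by apply/ffunP => u; rewrite ffunE ffun_rcons_widen.
move=> Y _ /=; apply/ffunP => u; rewrite ffunE.
by case: unliftP => [u'|] ->; rewrite // ffunE widen_ord_lift.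
Qed.

Lemma det_expand_sum (R : comNzRingType) k (A B : 'M[R]_k) :
  \det (A + B) =
  \sum_(S : {set 'I_k}) \det (\matrix_(c, r) if c \in S then A c r else B c r).
Proof.
rewrite /determinant exchange_big /=; apply: eq_bigr => s _.
under eq_bigr do rewrite mxE.
rewrite bigA_distr mulr_sumr; apply: eq_bigr => S _.
by congr (_ * _); apply: eq_bigr => c _; rewrite mxE.
Qed.

Lemma det_row_scale (R : comNzRingType) k (A : 'M[R]_k) (d : 'I_k -> R) :
  \det (\matrix_(c, r) (d c * A c r)) = (\prod_c d c) * \det A.
Proof.
rewrite /determinant mulr_sumr; apply: eq_bigr => s _.
under eq_bigr do rewrite mxE.
by rewrite big_split /= mulrCA.
Qed.

Lemma det_proportional_rows (R : comNzRingType) k (A : 'M[R]_k) i1 i2 (a : R) :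
  i1 != i2 -> A i1 =1 (fun r => a * A i2 r) -> \det A = 0.
Proof.
move=> ne e.
pose B := \matrix_(c, r) (if c == i1 then A i2 r else A c r).
have -> : A = \matrix_(c, r) ((if c == i1 then a else 1) * B c r).
  apply/matrixP => c r; rewrite !mxE; case: eqP => [->|_]; first exact: e.
  by rewrite mul1r.
rewrite det_row_scale (@determinant_alternate _ _ B _ _ ne) ?mulr0 // => r.
by rewrite !mxE eqxx eq_sym (negbTE ne).
Qed.

Section DetWhirl.
Variables (R : comNzRingType) (w : nat -> int -> R) (N k : nat) (t : R) (b0 : int).
Variable f0 : 'I_k -> int -> R.
Hypothesis f_wrap : forall v r b, b0 <= b ->
  whirl w (f0 r) v (b + N%:Z) = t * whirl w (f0 r) v b.

(** Steps have length at most one, so paths cannot jump over each other. At the first crossing two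
    positions coincide, giving equal rows, or lie exactly [N] apart, giving proportional rows by
    [f_wrap]. *)
Lemma det_whirl_crossing v (q : 'I_k -> int) (S : {set 'I_k}) :
  noncrossing N q -> (forall c, b0 <= q c) ->
  ~~ noncrossing N (fun c => q c + (c \notin S)%:Z) ->
  \det (\matrix_(c, r) whirl w (f0 r) v (q c + (c \notin S)%:Z)) = 0.
Proof.
move=> /noncrossingP Hq Hb; rewrite negb_forall => /existsP[c].
rewrite negb_forall => /existsP[c']; rewrite negb_imply => /andP[lt].
have := Hq _ _ lt; have nec : c != c' by rewrite -val_eqE neq_ltn lt.
move=> /andP[h1 h2] H.
have [e|e] : q c' + (c' \notin S)%:Z = q c + (c \notin S)%:Z \/
             q c + (c \notin S)%:Z = q c' + (c' \notin S)%:Z + N%:Z.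
- by move: h1 h2 H; case: (_ \notin _); case: (_ \notin _); lia.
- by apply: (@determinant_alternate _ _ _ _ _ nec) => r; rewrite !mxE e.
apply: (@det_proportional_rows _ _ _ c c' t nec) => r; rewrite !mxE e f_wrap //.
by have := Hb c'; case: (_ \notin _); lia.
Qed.

(** Multilinearity in the rows: [S] collects the rows in which the weighted term is chosen, that is,
    the paths that stay in place. *)
Lemma det_whirl_step v (q : 'I_k -> int) :
  noncrossing N q -> (forall c, b0 <= q c) ->
  \det (\matrix_(c, r) whirl w (f0 r) v.+1 (q c)) =
  \sum_(S : {set 'I_k} | noncrossing N (fun c => q c + (c \notin S)%:Z))
    (\prod_(c in S) w v (q c)) *
    \det (\matrix_(c, r) whirl w (f0 r) v (q c + (c \notin S)%:Z)).
Proof.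
move=> Hq Hb.
have -> : \matrix_(c, r) whirl w (f0 r) v.+1 (q c) =
    \matrix_(c, r) (w v (q c) * whirl w (f0 r) v (q c)) +
    \matrix_(c, r) whirl w (f0 r) v (q c + 1).
  by apply/matrixP => c r; rewrite !mxE.
rewrite det_expand_sum [RHS]big_mkcond /=; apply: eq_bigr => S _.
transitivity ((\prod_(c in S) w v (q c)) *
    \det (\matrix_(c, r) whirl w (f0 r) v (q c + (c \notin S)%:Z))); last first.
  by case: ifPn => // H; rewrite (det_whirl_crossing v Hq Hb H) mulr0.
rewrite (big_mkcond (fun c => c \in S)) -det_row_scale; congr (\det _).
apply/matrixP => c r; rewrite !mxE; case: (boolP (c \in S)) => _ /=.
  by rewrite addr0.
by rewrite mul1r.
Qed.

Lemma height_pos_rcons m (q : 'I_k -> int) S (Y : {ffun 'I_m -> {set 'I_k}}) v c :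
  (v <= m)%N ->
  height_pos q (ffun_rcons S Y) v c =
  height_pos (fun c => q c + (c \notin S)%:Z) Y v c.
Proof.
move=> lvm; rewrite /height_pos big_mkcond big_ord_recr /= ffun_rcons_max lvm.
rewrite [in RHS]big_mkcond /=.
under eq_bigr do rewrite ffun_rcons_widen.
by rewrite PoszD addrA addrAC.
Qed.

Lemma height_pos_last m (q : 'I_k -> int) (Y : {ffun 'I_m -> {set 'I_k}}) v c :
  (m <= v)%N -> height_pos q Y v c = q c.
Proof.
move=> le; rewrite /height_pos big1 ?addr0 // => u.
by rewrite leqNgt (leq_trans (ltn_ord u) le).
Qed.

Lemma chain_rcons m (q : 'I_k -> int) S (Y : {ffun 'I_m -> {set 'I_k}}) :
  noncrossing N q ->
  chain N q (ffun_rcons S Y) =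
  chain N (fun c => q c + (c \notin S)%:Z) Y.
Proof.
move=> Hq; apply/forallP/forallP => H v.
  have := H (widen_ord (leqnSn m.+1) v); rewrite /= => {}H.
  rewrite -(eq_noncrossing N (fun c => height_pos_rcons q S Y c _)) //.
  by rewrite -ltnS.
case: (leqP v m) => [le|lt].
  rewrite (eq_noncrossing N (fun c => height_pos_rcons q S Y c le)).
  have := H (inord v); rewrite inordK //.
by rewrite (eq_noncrossing N (fun c => height_pos_last q _ c lt)).
Qed.

Lemma chain_noncrossing m (q : 'I_k -> int) (Y : {ffun 'I_m -> {set 'I_k}}) :
  chain N q Y -> noncrossing N q.
Proof.
move/forallP => /(_ ord_max).
by rewrite (eq_noncrossing N (fun c => height_pos_last q _ c (leqnn _))).
Qed.

Lemma chain_weight_rcons m (q : 'I_k -> int) S (Y : {ffun 'I_m -> {set 'I_k}}) :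
  chain_weight w q (ffun_rcons S Y) =
  (\prod_(c in S) w m (q c)) *
  chain_weight w (fun c => q c + (c \notin S)%:Z) Y.
Proof.
rewrite /chain_weight big_ord_recr /= ffun_rcons_max mulrC; congr (_ * _).
  by apply: eq_bigr => c _; rewrite height_pos_last.
apply: eq_bigr => u _; rewrite ffun_rcons_widen; apply: eq_bigr => c _.
by rewrite height_pos_rcons.
Qed.

(** A Lindström-Gessel-Viennot formula on the cylinder. The determinant at the ends of the paths is
    left unevaluated, since it is a plain indicator on a wide cylinder but a signed sum of monomials
    for the folded matrix. *)
Lemma det_whirl m (q : 'I_k -> int) :
  noncrossing N q -> (forall c, b0 <= q c) ->
  \det (\matrix_(c, r) whirl w (f0 r) m (q c)) =
  \sum_(Y : {ffun 'I_m -> {set 'I_k}} | chain N q Y)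
    chain_weight w q Y * \det (\matrix_(c, r) f0 r (height_pos q Y 0 c)).
Proof.
elim: m q => [|m IH] q Hq Hb.
  have e (Y : {ffun 'I_0 -> {set 'I_k}}) v c : height_pos q Y v c = q c.
    by rewrite height_pos_last.
  rewrite (big_pred1 [ffun => set0]) => [|Y].
    rewrite /chain_weight big_ord0 mul1r; congr (\det _).
    by apply/matrixP => c r; rewrite !mxE e.
  have -> : Y = [ffun => set0] by apply/ffunP => -[].
  rewrite [RHS]/= eqxx; apply/forallP => v.
  by rewrite (eq_noncrossing N (e _ _)).
rewrite det_whirl_step // big_mkcond [RHS]big_mkcond big_ffun_recr /=.
apply: eq_bigr => S _.
under [RHS]eq_bigr do rewrite chain_rcons //.
rewrite -big_mkcond; case: ifPn => [H|H]; last first.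
  rewrite big1 // => Y /chain_noncrossing.
  by rewrite (negbTE H).
rewrite IH //; last by move=> c; apply: le_trans (Hb c) _; rewrite lerDl.
rewrite mulr_sumr; apply: eq_bigr => Y _.
rewrite chain_weight_rcons mulrA; congr (_ * \det _).
by apply/matrixP => c r; rewrite !mxE height_pos_rcons.
Qed.

End DetWhirl.

(** * Cylindric tableaux as noncrossing paths *)

(** The [k]-cylindric condition on column lengths, with [N] in the role of [n]. *)
Definition cyl_heights (N k : nat) (H : 'I_k -> nat) : Prop :=
  (forall c c' : 'I_k, (c <= c')%N -> (H c' <= H c)%N) /\
  (forall c c' : 'I_k, (H c <= H c' + (N - k))%N).

Lemma noncrossing_heights (N k : nat) (H : 'I_k -> nat) (C : int) q :
  (k <= N)%N -> (forall c : 'I_k, q c = C - c%:Z + (H c)%:Z) ->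
  (noncrossing N q : Prop) <-> cyl_heights N H.
Proof.
move=> lekN eq_q; split=> [/noncrossingP nc|[mono cyc]]; last first.
  apply/noncrossingP => c c' lt; rewrite !eq_q.
  by have := mono c c' (ltnW lt); have := cyc c c'; have := ltn_ord c'; lia.
have mono (c c' : 'I_k) : (c <= c')%N -> (H c' <= H c)%N.
  move=> le; have [d e] : exists d, (c' = c + d :> nat)%N by exists (c' - c)%N; lia.
  elim: d c' e {le} => [|d IH] c' e.
    by have -> : c' = c by apply: val_inj; rewrite /= e addn0.
  have lt : (c + d < k)%N by have := ltn_ord c'; lia.
  apply: leq_trans (IH (Ordinal lt) erefl).
  have : (Ordinal lt < c')%N by rewrite e /= addnS.
  by move/nc; rewrite !eq_q e /=; lia.
split=> // c c'; have k_gt0 : (0 < k)%N by case: (k) c => [[]|].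
pose c0 := Ordinal k_gt0; have lt : (k.-1 < k)%N by rewrite prednK.
have h1 := mono c0 c (leq0n _).
have h2 : (H (Ordinal lt) <= H c')%N.
  by apply: mono; rewrite /= -ltnS prednK.
(* A single column offers no pair to compare; the bound then compares a height with itself. *)
case: (posnP k.-1) => e.
  have ec : (Ordinal lt) = c0 by apply: val_inj.
  by rewrite ec in h2; lia.
have : (c0 < Ordinal lt)%N by [].
by move/nc; rewrite !eq_q /=; lia.
Qed.

Lemma card_ord_lt l i : (i <= l)%N -> #|[pred j : 'I_l | (j < i)%N]| = i.
Proof.
move=> le; rewrite -sum1_card (eq_bigl (fun j : 'I_l => (j < i)%N)) //.
by rewrite (big_ord_narrow le) /= sum_nat_const card_ord muln1.
Qed.

Lemma card_initial_segment l (P : pred 'I_l) :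
  (forall i j : 'I_l, (i <= j)%N -> P j -> P i) ->
  forall i : 'I_l, P i = (i < #|P|)%N.
Proof.
move=> down i; apply/idP/idP => [Pi|].
  rewrite -[X in (X <= _)%N](card_ord_lt (ltn_ord i)); apply: subset_leq_card.
  by apply/subsetP => j; rewrite !inE ltnS => le; apply: (down j i).
apply: contraLR => nPi; rewrite -leqNgt.
rewrite -[X in (_ <= X)%N](card_ord_lt (ltnW (ltn_ord i))); apply: subset_leq_card.
apply/subsetP => j; rewrite !inE => Pj; rewrite ltnNge; apply/negP => le.
by rewrite (down _ _ le Pj) in nPi.
Qed.

Section Tableaux.
Variables (F : fieldType) (m n : nat) (x : 'M[F]_(m, n)).

(** The shift by [v] cancels the one in the definition of x_i^{(r)}: [row_var v b] is x_{v+1}^j with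
    j congruent to [b] mod [n], a diagonal entry of a whirl matrix. *)
Definition row_var (v : nat) (b : int) : F :=
  if insub v is Some v' then loop_var x v' (b + v%:Z) else 0.

Lemma row_var_ord (v : 'I_m) b : row_var v b = loop_var x v (b + v%:Z).
Proof. by rewrite /row_var valK. Qed.

Variables (N k : nat) (sh : skew_shape) (L M : 'I_k -> nat) (r : int).
Hypothesis m_gt0 : (0 < m)%N.
Hypothesis le_kN : (k <= N)%N.
Hypothesis le_ML : forall c, (M c <= L c)%N.
Hypothesis M_cyl : cyl_heights N M.
Hypothesis L_cyl : cyl_heights N L.
Hypothesis cellsP : forall a b, ((a, b) \in skew_cells sh) <->
  exists c : 'I_k, b = c.+1 /\ (M c < a <= L c)%N.

Let q (c : 'I_k) : int := r - m%:Z + (L c)%:Z - c%:Z.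

Implicit Types (s : cell sh) (T : filling sh m) (Y : {ffun 'I_m -> {set 'I_k}}).

Let cell_in s : exists c : 'I_k, cell_col s = c.+1 /\ (M c < cell_row s <= L c)%N.
Proof.
by apply/cellsP; rewrite -surjective_pairing; apply: ssvalP.
Qed.

Let col_lt s : ((cell_col s).-1 < k)%N.
Proof. by have [c [-> _]] := cell_in s; apply: ltn_ord. Qed.

Let col s : 'I_k := Ordinal (col_lt s).

Let colE s : cell_col s = (col s).+1.
Proof. by have [c [e _]] := cell_in s; rewrite /= e. Qed.

Let row_in s : (M (col s) < cell_row s <= L (col s))%N.
Proof.
have [c [e h]] := cell_in s; suff -> : col s = c by [].
by apply: val_inj; rewrite /= e.
Qed.

Let cell_inj s s' : col s = col s' -> cell_row s = cell_row s' -> s = s'.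
Proof.
move=> e1 e2; apply: val_inj; rewrite [LHS]surjective_pairing [RHS]surjective_pairing.
by congr pair => //; have := colE s; rewrite e1 -colE.
Qed.

Let mk_cell (c : 'I_k) (a : nat) : (M c < a <= L c)%N ->
  exists s : cell sh, col s = c /\ cell_row s = a.
Proof.
move=> h; have H : (a, c.+1) \in skew_cells sh by apply/cellsP; exists c.
by exists (SeqSub H); split => //; apply: val_inj.
Qed.

(** The lower end of column [c] in the subshape formed by mu and the cells with entry at most [v],
    entries being counted from 1. These subshapes interpolate between [M] and [L]. *)
Let ht Y (v : nat) (c : 'I_k) : nat := (M c + \sum_(u < m | (u < v)%N) (c \in Y u))%N.

Let ht0 Y c : ht Y 0 c = M c.
Proof. by rewrite /ht big_pred0 ?addn0. Qed.

Let htS Y (u : 'I_m) c : ht Y u.+1 c = (ht Y u c + (c \in Y u))%N.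
Proof.
rewrite /ht (bigD1 u) //= addnA addnAC; congr (_ + _ + _)%N.
by apply: eq_bigl => u'; rewrite ltnS [RHS]ltn_neqAle andbC.
Qed.

Let ht_mono Y v v' c : (v <= v')%N -> (ht Y v c <= ht Y v' c)%N.
Proof.
move=> le; rewrite leq_add2l big_mkcond [leqRHS]big_mkcond /=.
apply: leq_sum => u _; case: ltnP => // lt.
by rewrite (leq_trans lt le).
Qed.

Let height_posE Y v c : (v <= m)%N ->
  height_pos q Y v c =
  r - v%:Z - c%:Z + (ht Y v c)%:Z + ((L c)%:Z - (ht Y m c)%:Z).
Proof.
move=> le; rewrite /height_pos /q /ht.
have -> : (\sum_(u < m | u < m) (c \in Y u) =
           \sum_(u < m | u < v) (c \in Y u) + \sum_(u < m | v <= u) (c \in Y u))%N.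
  rewrite (eq_bigl xpredT) => [|u]; last by rewrite ltn_ord.
  rewrite (bigID (fun u : 'I_m => (u < v)%N)) /=; congr (_ + _)%N.
  by apply: eq_bigl => u; rewrite -leqNgt.
have : (\sum_(u < m | v <= u) (c \notin Y u) +
        \sum_(u < m | v <= u) (c \in Y u) = m - v)%N.
  rewrite -big_split /= (eq_bigr (fun=> 1%N)); last by move=> u _; case: (_ \in _).
  by rewrite -(big_geq_mkord v m xpredT (fun=> 1%N)) sum_nat_const_nat muln1.
set A := (\sum_(u < m | (v <= u)%N) (c \notin Y u))%N.
set B := (\sum_(u < m | (v <= u)%N) (c \in Y u))%N.
set C := (\sum_(u < m | (u < v)%N) (c \in Y u))%N.
by lia.
Qed.

(** The graph of the bijection. Each side determines the other ([cut_inj], [values_cut]), so it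
    suffices to produce a partner on either side and to read conditions and weights off this
    relation. *)
Let cut T Y := [/\ forall c, ht Y m c = L c &
  forall s v, (v <= m)%N -> (T s < v)%N = (cell_row s <= ht Y v (col s))%N].

Let values T : {ffun 'I_m -> {set 'I_k}} :=
  [ffun u => [set c | [exists s, (col s == c) && (T s == u)]]].

(** The entry of a cell is the number of levels that do not yet reach it. The default of [insubd]
    can occur only if column heights fall short of [L] at level [m]. *)
Let filling_of Y : filling sh m :=
  [ffun s => insubd (Ordinal m_gt0)
     #|[pred v : 'I_m | (ht Y v.+1 (col s) < cell_row s)%N]|].

(** Strict columns contain each entry at most once, so counting the entries below [v] in a column
    counts its cells, and these cells form an initial segment. *)
Let cut_values T : (forall s s', col s = col s' -> (cell_row s < cell_row s')%N ->
  (T s < T s')%N) -> cut T (values T).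
Proof.
move=> strict.
have cellk c (i : 'I_(L c - M c)) :
    exists s, (col s == c) && (cell_row s == (M c + i).+1).
  have [|s [e1 e2]] := @mk_cell c (M c + i).+1; first by have := ltn_ord i; lia.
  by exists s; rewrite e1 e2 !eqxx.
pose S c i := xchoose (cellk c i).
have SP c i : col (S c i) = c /\ cell_row (S c i) = (M c + i).+1.
  by have /andP[/eqP e1 /eqP e2] := xchooseP (cellk c i).
have f_mono c (i j : 'I_(L c - M c)) : (i < j)%N -> (T (S c i) < T (S c j))%N.
  move=> lt; have [e1 e2] := SP c i; have [e3 e4] := SP c j.
  by apply: strict; rewrite ?e1 ?e3 // e2 e4 ltnS ltn_add2l.
have htE v c : ht (values T) v c = (M c + #|[pred i | (T (S c i) < v)%N]|)%N.
  rewrite /ht; congr (_ + _)%N.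
  have inj : injective (fun i => T (S c i)).
    move=> i j /= e; apply: val_inj; case: (ltngtP i j) => //= lt.
      by have := f_mono _ _ _ lt; rewrite e ltnn.
    by have := f_mono _ _ _ lt; rewrite e ltnn.
  rewrite -(card_image inj) -sum1_card big_mkcond [RHS]big_mkcond /=.
  apply: eq_bigr => u _; rewrite !ffunE inE.
  case: (boolP (u \in image _ _)) => [im | notin].
    have [i + ->] := elimT imageP im; rewrite inE => lt; rewrite lt.
    case: existsP => // -[]; exists (S c i).
    by have [-> _] := SP c i; rewrite !eqxx.
  case: ltnP => // lt; case: existsP => // -[s /andP[/eqP ec /eqP eT]].
  case/negP: notin; apply/imageP.
  have h := row_in s; rewrite ec in h.
  have lti : (cell_row s - (M c).+1 < L c - M c)%N by lia.
  have es : s = S c (Ordinal lti).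
    have [e1 e2] := SP c (Ordinal lti); apply: cell_inj; rewrite ?e1 ?e2 //=; lia.
  by exists (Ordinal lti); rewrite ?inE -?es eT.
split=> [c|s v le].
  rewrite htE; have -> : #|[pred i | (T (S c i) < m)%N]| = (L c - M c)%N.
    by rewrite -[RHS]card_ord; apply: eq_card => i; rewrite !inE ltn_ord.
  by have := le_ML c; lia.
rewrite htE; set c := col s; have h := row_in s; rewrite -/c in h.
have lti : (cell_row s - (M c).+1 < L c - M c)%N by lia.
have es : s = S c (Ordinal lti).
  have [e1 e2] := SP c (Ordinal lti); apply: cell_inj; rewrite ?e1 ?e2 //=; lia.
have down (i j : 'I_(L c - M c)) : (i <= j)%N ->
    [pred i | (T (S c i) < v)%N] j -> [pred i | (T (S c i) < v)%N] i.
  rewrite leq_eqVlt => /orP[/eqP/val_inj -> //|lt] /=.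
  by apply: ltn_trans; apply: f_mono.
have := card_initial_segment down (Ordinal lti).
rewrite /= -es => ->.
set A := #|_|.
by case/andP: h => h1 h2; apply/idP/idP; clearbody A; clear -h1 h2; lia.
Qed.

Let cut_filling Y : (forall c, ht Y m c = L c) -> cut (filling_of Y) Y.
Proof.
move=> hm; split=> // s v le.
pose P := [pred v : 'I_m | (ht Y v.+1 (col s) < cell_row s)%N].
have down (i j : 'I_m) : (i <= j)%N -> P j -> P i.
  by move=> lij /=; apply: leq_ltn_trans; apply: ht_mono.
have PE := card_initial_segment down.
have ltm : (#|P| < m)%N.
  have lt : (m.-1 < m)%N by rewrite prednK.
  have := PE (Ordinal lt); rewrite /= prednK // hm.
  have /andP[_ h] := row_in s; rewrite ltnNge h /= => /esym/negbT.
  by rewrite -ltnNge.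
rewrite ffunE val_insubd ltm; case: v le => [|v] le.
  by rewrite ht0 ltn0; have := row_in s; lia.
have := PE (Ordinal le); rewrite /= => e.
by rewrite ltnS leqNgt -e -leqNgt.
Qed.

Let cut_inj T T' Y : cut T Y -> cut T' Y -> T = T'.
Proof.
move=> [_ h] [_ h']; apply/ffunP => s; apply: val_inj.
have e v : (v <= m)%N -> (T s < v)%N = (T' s < v)%N by move=> le; rewrite h // h'.
apply/eqP; rewrite eqn_leq; have := e (T s).+1 (ltn_ord _).
by have := e (T' s).+1 (ltn_ord _); rewrite !ltnS !leqnn => -> <-.
Qed.

Let cut_row T Y s : cut T Y -> ht Y (T s).+1 (col s) = cell_row s /\ col s \in Y (T s).
Proof.
move=> [_ h]; have := h s (T s).+1 (ltn_ord _); have := h s (T s) (ltnW (ltn_ord _)).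
rewrite ltnn ltnS leqnn htS; case: (_ \in _) => /=; last by rewrite addn0; lia.
by move=> h1 h2; split=> //; lia.
Qed.

Let values_cut T Y : cut T Y -> values T = Y.
Proof.
move=> hc; have [h0 h] := hc; apply/ffunP => u; apply/setP => c; rewrite ffunE inE.
apply/existsP/idP => [[s /andP[/eqP <- /eqP <-]]|cY].
  by have [] := cut_row s hc.
have hS := htS Y u c; rewrite cY in hS.
have := ht_mono Y c (leq0n u); rewrite ht0 => hM.
have := ht_mono Y c (ltn_ord u : (u.+1 <= m)%N); rewrite h0 => hL.
have [|s [e1 e2]] := @mk_cell c (ht Y u.+1 c); first by lia.
exists s; rewrite e1 eqxx /= -val_eqE /=; apply/eqP.
have := h s u (ltnW (ltn_ord u)); have := h s u.+1 (ltn_ord u).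
by rewrite e1 e2 leqnn; lia.
Qed.

Let cut_cylP T Y : cut T Y ->
  cylindric_tableau N k T <-> (forall v, (v <= m)%N -> cyl_heights N (ht Y v)).
Proof.
move=> hc; have [h0 h] := hc; split=> [cyl v le|cyl].
  have hM c : (M c <= ht Y v c)%N by rewrite leq_addr.
  have hL c : (ht Y v c <= L c)%N by rewrite -h0 ht_mono.
  split=> c c' => [lec|]; rewrite leqNgt; apply/negP => lt.
    have [|s' [e1 e2]] := @mk_cell c' (ht Y v c').
      by have := M_cyl.1 _ _ lec; have := hM c; have := hL c'; lia.
    have [|s [e3 e4]] := @mk_cell c (ht Y v c').
      by have := L_cyl.1 _ _ lec; have := hM c; have := hL c'; lia.
    have [+ _] := cyl 0 0 s s'.
    rewrite /translate_row /translate_col !mul0r !addr0 !colE e1 e2 e3 e4 => /(_ erefl) H.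
    have {}H : (T s <= T s')%N by apply: H; lia.
    have := h s' v le; rewrite e1 e2 leqnn => /(leq_ltn_trans H).
    by rewrite (h s v le) e3 e4 leqNgt lt.
  pose a := (ht Y v c - (N - k))%N.
  have [|s' [e1 e2]] := @mk_cell c (ht Y v c).
    by have := M_cyl.2 c c'; have := hM c'; have := hL c; lia.
  have [|s [e3 e4]] := @mk_cell c' a.
    by rewrite /a; have := L_cyl.2 c c'; have := hM c'; have := hL c; lia.
  (* The next translate lies [k] columns to the right and [N - k] rows up: it moves row [ht Y v c]
     of column [c] to row [a], to the right of column [c']. *)
  have [+ _] := cyl 0 1 s s'.
  rewrite /translate_row /translate_col !mul0r !addr0 !mul1r !colE e1 e2 e3 e4 => H.
  have {}H : (T s <= T s')%N.
    by apply: H; rewrite /a; have := ltn_ord c'; lia.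
  have := h s' v le; rewrite e1 e2 leqnn => /(leq_ltn_trans H).
  by rewrite (h s v le) e3 e4 /a; lia.
move=> d d' s s'; rewrite /translate_row /translate_col !colE.
have hs := row_in s; have hs' := row_in s'.
have lt1 := ltn_ord (col s); have lt2 := ltn_ord (col s').
split=> [er lec|ec ltr]; last first.
  have ed : d = d' by nia.
  rewrite ed in ec ltr; have ecol : col s = col s' by apply: ord_inj; lia.
  rewrite (h s (T s')) ?ecol; last by apply/ltnW/ltn_ord.
  have [e _] := cut_row s' hc.
  by have := htS Y (T s') (col s'); case: (_ \in _); lia.
rewrite leqNgt; apply/negP => ltT.
have lev := ltnW (ltn_ord (T s)).
have [mono cyc] := cyl _ lev.
have h1 := h s (T s) lev; have h2 := h s' (T s) lev; rewrite ltT in h2.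
rewrite ltnn in h1.
(* Columns of the shape lie in a window of width [k], so the order of the translated columns bounds
   the order of the translates. *)
have hd : d <= d' by nia.
have [ed|nd] := eqVneq d d'.
  rewrite ed in er lec; have lecol : (col s <= col s')%N by lia.
  by have := mono _ _ lecol; lia.
have := cyc (col s') (col s).
have : (d' - d) * (N%:Z - k%:Z) = (cell_row s')%:Z - (cell_row s)%:Z.
  by rewrite mulrBl !mulrBr in er *; lia.
have : 1 <= d' - d by lia.
by nia.
Qed.

Let cut_weight T Y : cut T Y -> weight x r T = chain_weight row_var q Y.
Proof.
move=> hc; have [h0 h] := hc.
rewrite /chain_weight pair_big_dep /=.
pose phi s := (T s, col s).
have inj : injective phi.
  move=> s s' e; have eT : T s = T s' := congr1 fst e.
  have ec : col s = col s' := congr1 snd e; apply: cell_inj => //.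
  have [<- _] := cut_row s hc; have [<- _] := cut_row s' hc.
  by rewrite eT ec.
rewrite (eq_bigl (mem (phi @: setT))); last first.
  move=> [u c] /=; rewrite -[in LHS](values_cut hc) ffunE inE.
  apply/existsP/imsetP => [[s /andP[/eqP <- /eqP <-]]|[s _ [-> ->]]].
    by exists s.
  by exists s; rewrite !eqxx.
rewrite big_imset /=; last by move=> s s' _ _; apply: inj.
rewrite /weight; apply: eq_big => [s|s _]; first by rewrite inE.
rewrite row_var_ord height_posE // h0; have [e _] := cut_row s hc; rewrite e.
congr (loop_var _ _ _); rewrite /content colE; lia.
Qed.

(** The end condition on the paths says that [Y] fills each column from [M] exactly up to [L]. *)
Lemma cyl_tableaux_chains :
  \sum_(T : filling sh m | `[< cylindric_tableau N k T >]) weight x r T =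
  \sum_(Y : {ffun 'I_m -> {set 'I_k}} | chain N q Y &&
     [forall c, height_pos q Y 0 c == r + (M c)%:Z - c%:Z])
   chain_weight row_var q Y.
Proof.
have cut_of_cyl T : cylindric_tableau N k T -> cut T (values T).
  move=> cyl; apply: cut_values => s s' ec lt.
  have [_] := cyl 0 0 s s'; apply.
    by rewrite /translate_col !mul0r !addr0 !colE ec.
  by rewrite /translate_row !mul0r !addr0.
have chainE Y : (forall c, ht Y m c = L c) ->
    (chain N q Y : Prop) <-> forall v, (v <= m)%N -> cyl_heights N (ht Y v).
  move=> h0; have E v : (v <= m)%N ->
      (noncrossing N (height_pos q Y v) : Prop) <-> cyl_heights N (ht Y v).
    move=> le; apply: (@noncrossing_heights _ _ _ (r - v%:Z)) => // c.
    by rewrite height_posE // h0 subrr addr0.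
  split=> [/forallP H v le|H]; first by apply/E => //; apply: (H (Ordinal (le : v < m.+1)%N)).
  by apply/forallP => v; apply/E; [|apply: H]; rewrite -ltnS.
rewrite (reindex_onto filling_of values) /=; last first.
  move=> T /asboolP /cut_of_cyl hc; have [h0 _] := hc.
  exact: cut_inj (cut_filling h0) hc.
have endE Y : [forall c, height_pos q Y 0 c == r + (M c)%:Z - c%:Z] =
    [forall c, ht Y m c == L c].
  apply: eq_forallb => c; rewrite height_posE // ht0; lia.
apply: eq_big => [Y|Y /andP[/asboolP cyl /eqP e]]; last first.
  by have hc := cut_of_cyl _ cyl; rewrite e in hc; apply: cut_weight.
rewrite endE; apply/andP/andP => [[/asboolP cyl /eqP e]|[ch /forallP eL]].
  have hc := cut_of_cyl _ cyl; rewrite e in hc; have [h0 _] := hc.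
  split; last by apply/forallP => c; rewrite h0.
  by apply/chainE => //; apply/(cut_cylP hc).
have {}eL c : ht Y m c = L c by apply/eqP.
have hc := cut_filling eL; rewrite (values_cut hc); split=> //.
by apply/asboolP/(cut_cylP hc)/chainE.
Qed.

End Tableaux.

(** * Entries of the whirl product *)

Lemma perm_increasing_id k (s : 'S_k) :
  (forall c c' : 'I_k, (c < c')%N -> (s c < s c')%N) -> s = 1%g.
Proof.
move=> incr; apply/permP => c; rewrite perm1; apply: ord_inj.
rewrite -(card_ord_lt (ltnW (ltn_ord (s c)))) -(card_ord_lt (ltnW (ltn_ord c))).
rewrite -[RHS](card_image (@perm_inj _ s)); apply: eq_card => j; rewrite [LHS]inE.
apply/idP/imageP => [lt|[i + ->]]; last by rewrite inE => /incr.
exists ((s^-1)%g j); last by rewrite permKV.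
rewrite inE ltnNge; apply/negP => le; move: lt; rewrite -{1}(permKV s j).
rewrite ltnNge; case/negP; move: le; rewrite leq_eqVlt => /orP[/eqP|/incr/ltnW //].
by move/ord_inj <-.
Qed.

(** Both [p] and [q] are spread over less than one period, so two windings differ by at most one.
    Hence the [z c] all lie on one side of their mean [G] and so equal it; the permutation then
    preserves the order. *)
Lemma perm_winding_id N k (p q : 'I_k -> int) (s : 'S_k) (z : 'I_k -> int) (G : int) :
  noncrossing N p -> noncrossing N q ->
  (forall c, q c = p (s c) + N%:Z * z c) -> \sum_c z c = G *+ k ->
  s = 1%g /\ forall c, q c = p c + N%:Z * G.
Proof.
move=> /noncrossingP Hp /noncrossingP Hq e sz.
have close c' c'' : z c' <= z c'' + 1.
  have hq : q c' - q c'' < N%:Z \/ c' = c''.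
    case: (ltngtP c' c'') => [lt|lt|/ord_inj ->]; [left|left|by right].
      by have := Hq _ _ lt; lia.
    by have := Hq _ _ lt; lia.
  have hp : p (s c'') - p (s c') < N%:Z \/ s c' = s c''.
    case: (ltngtP (s c') (s c'')) => [lt|lt|/ord_inj ->]; [left|left|by right].
      by have := Hp _ _ lt; lia.
    by have := Hp _ _ lt; lia.
  case: hq => [hq|->]; last by lia.
  case: hp => [hp|/perm_inj ec]; last by rewrite ec; lia.
  by move: hq; rewrite !e; nia.
have sz0 : \sum_c (z c - G) = 0.
  by rewrite sumrB sz sumr_const card_ord subrr.
have zG c : z c = G.
  case: (boolP [forall c, G <= z c]) => [/forallP ge|].
    have ge0 c1 : predT c1 -> 0 <= z c1 - G by move=> _; rewrite subr_ge0.
    by apply/eqP; rewrite -subr_eq0; apply/eqP; apply: (psumr_eq0P ge0 sz0).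
  rewrite negb_forall => /existsP[c2]; rewrite -ltNge => lt.
  have ge0 c1 : predT c1 -> 0 <= - (z c1 - G).
    by move=> _; have := close c1 c2; lia.
  have sz1 : \sum_c - (z c - G) = 0 by rewrite sumrN sz0 oppr0.
  by have := psumr_eq0P ge0 sz1 (isT : predT c); lia.
have s1 : s = 1%g.
  apply: perm_increasing_id => c c' lt.
  have := Hq _ _ lt; rewrite !e !zG; case: (ltngtP (s c) (s c')) => // [lt'|].
    by have := Hp _ _ lt'; lia.
  by move/ord_inj->; rewrite ltxx.
by split=> // c; rewrite e zG s1 perm1.
Qed.

Section Entries.
Variables (F : fieldType) (m n : nat) (x : 'M[F]_(m, n)).

Lemma loop_var_period (i : 'I_m) (r z : int) :
  loop_var x i (r + n%:Z * z) = loop_var x i r.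
Proof.
rewrite /loop_var; congr (if _ is Some j then x i j else 0).
apply: eq_pick => j; congr (_ == _).
have -> : r + n%:Z * z - i.+1%:Z + 1 = z * n%:Z + (r - i.+1%:Z + 1) by ring.
by rewrite modzMDl.
Qed.

Lemma row_var_period v (b z : int) : row_var x v (b + n%:Z * z) = row_var x v b.
Proof.
by rewrite /row_var; case: insub => // v'; rewrite addrAC loop_var_period.
Qed.

(** The integer-indexed periodic matrix whose generating function is the folded matrix; it is
    supported in the band [a - v <= b <= a]. *)
Definition entry (v : nat) (a b : int) : F :=
  whirl (row_var x) (fun b => (a == b)%:R) v b.

Lemma entry_lt v (a b : int) : b < a - v%:Z -> entry v a b = 0.
Proof.
elim: v b => [|v IH] b lt; rewrite /entry /=.
  by case: eqP => // e; move: lt; rewrite e subr0 ltxx.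
by rewrite -!/(entry _ _ _) !IH ?mulr0 ?addr0 //; lia.
Qed.

Lemma entry_gt v (a b : int) : a < b -> entry v a b = 0.
Proof.
elim: v b => [|v IH] b lt; rewrite /entry /=.
  by case: eqP => // e; move: lt; rewrite e ltxx.
by rewrite -!/(entry _ _ _) !IH ?mulr0 ?addr0 //; lia.
Qed.

Lemma entry_low v (a b : int) : b = a - v%:Z -> entry v a b = 1.
Proof.
elim: v b => [|v IH] b e; rewrite /entry /=; first by rewrite e subr0 eqxx.
by rewrite -!/(entry _ _ _) entry_lt ?mulr0 ?add0r ?IH //; lia.
Qed.

Lemma entry_period v (a b z : int) :
  entry v (a + n%:Z * z) (b + n%:Z * z) = entry v a b.
Proof.
elim: v b => [|v IH] b; rewrite /entry /=.
  by rewrite (inj_eq (addIr _)).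
by rewrite -!/(entry _ _ _) row_var_period IH addrAC IH.
Qed.

Hypothesis n_gt0 : (0 < n)%N.

(** For [a <= n] and [1 <= b] an exact quotient of [b - a] by [n] is nonnegative, so the absolute
    value is harmless; this is the origin of the two bounds in the lemmas below. *)
Definition unfolded0 (a b : int) : {poly F} :=
  if (n%:Z %| b - a)%Z then 'X^`|((b - a) %/ n%:Z)%Z| else 0.

(* Row [a], column [b] of the folded matrix, columns being extended from
   [[1, n]] to all positive integers by [column (b + n) = 'X * column b]. *)
Definition folded (v : nat) (a b : int) : {poly F} :=
  whirl (fun v b => (row_var x v b)%:P) (unfolded0 a) v b.

Lemma folded_wrap v (a b : int) : a <= n%:Z -> 1 <= b ->
  folded v a (b + n%:Z) = 'X * folded v a b.
Proof.
move=> lea; elim: v b => [|v IH] b leb; rewrite /folded /=.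
  rewrite /unfolded0; have -> : b + n%:Z - a = b - a + n%:Z by ring.
  rewrite (rpredDr _ (dvdzz _)); case: ifP; last by rewrite mulr0.
  case/dvdzP => z e; have n0 : n%:Z != 0 by lia.
  have z_ge0 : 0 <= z by nia.
  rewrite e -[X in z * _ + X]mul1r -mulrDl !mulzK // -exprS; congr ('X^_); lia.
rewrite -!/(folded _ _ _) -[in row_var _ _ (b + _)](mulr1 n%:Z) row_var_period.
rewrite IH // addrAC IH ?mulrDr; last by lia.
by rewrite mulrCA.
Qed.

Lemma coef_folded v (a b : int) d : a <= n%:Z -> 1 <= b ->
  (folded v a b)`_d = entry v a (b - n%:Z * d%:Z).
Proof.
move=> lea; elim: v b => [|v IH] b leb; rewrite /folded /entry /=; last first.
  rewrite -!/(folded _ _ _) -!/(entry _ _ _) coefD coefCM (IH _ leb) IH; last by lia.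
  by rewrite -[in RHS]mulrN row_var_period addrAC mulrN.
rewrite /unfolded0; have n0 : n%:Z != 0 by lia.
case: ifP => [/dvdzP[z e]|nd].
  have z_ge0 : 0 <= z by nia.
  rewrite e mulzK // coefXn; congr ((nat_of_bool _)%:R).
  by apply/eqP/eqP => e'; nia.
rewrite coef0; case: eqP => // e; move: nd.
rewrite e; have -> : b - (b - n%:Z * d%:Z) = d%:Z * n%:Z by ring.
by rewrite dvdz_mull ?dvdzz.
Qed.

End Entries.

(** * Determinantal formulas *)

Lemma det_indicator (R : comNzRingType) N k (p q : 'I_k -> int) :
  noncrossing N p -> noncrossing N q ->
  \det (\matrix_(c, r) (p r == q c)%:R : 'M[R]_k) = [forall c, q c == p c]%:R.
Proof.
move=> /noncrossingP Hp /noncrossingP Hq.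
rewrite /determinant (bigD1 1%g) //= [X in _ + X]big1 => [|s].
  rewrite addr0 odd_perm1 mul1r; case: (boolP [forall c, _]) => [/forallP H|].
    by rewrite big1 // => c _; rewrite !mxE perm1 (eqP (H c)) eqxx.
  rewrite negb_forall => /existsP[c /negbTE nc].
  by rewrite (bigD1 c) //= !mxE perm1 eq_sym nc mul0r.
move=> s1; case: (boolP [forall c, p (s c) == q c]) => [/forallP H|].
  case/eqP: s1; apply: perm_increasing_id => c c' lt.
  have := Hq _ _ lt; rewrite -!(eqP (H _)).
  case: (ltngtP (s c) (s c')) => // [lt'|/ord_inj->]; last by rewrite ltxx.
  by have := Hp _ _ lt'; lia.
rewrite negb_forall => /existsP[c /negbTE nc].
by rewrite (bigD1 c) //= !mxE nc mul0r mulr0.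
Qed.

(** A permutation contributes zero or a signed monomial whose exponent is its total winding;
    [perm_winding_id] leaves only the identity in degree [G * k]. *)
Lemma coef_det_unfolded0 (F : fieldType) n k (p q : 'I_k -> int) (G : nat) :
  (0 < n)%N -> noncrossing n p -> noncrossing n q ->
  (forall c, p c <= n%:Z) -> (forall c, 1 <= q c) ->
  (\det (\matrix_(c, r) unfolded0 F n (p r) (q c)))`_(G * k) =
  [forall c, q c == p c + n%:Z * G%:Z]%:R.
Proof.
move=> n_gt0 ncp ncq hp hq.
have n0 : n%:Z != 0 by lia.
pose B := [forall c, q c == p c + n%:Z * G%:Z].
have term (s : 'S_k) : (\prod_c unfolded0 F n (p (s c)) (q c))`_(G * k) =
    ((s == 1%g) && B)%:R.
  case: (boolP [forall c, (n%:Z %| q c - p (s c))%Z]) => [/forallP H|]; last first.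
    rewrite negb_forall => /existsP[c nd].
    rewrite (bigD1 c) //= /unfolded0 (negbTE nd) mul0r coef0.
    case: eqP => // es; case: (boolP B) => // /forallP/(_ c)/eqP e.
    by move: nd; rewrite es perm1 e addrAC subrr add0r dvdz_mulr ?dvdzz.
  rewrite (eq_bigr (fun c => 'X^`|((q c - p (s c)) %/ n%:Z)%Z|)) => [|c _]; last first.
    by rewrite /unfolded0 H.
  rewrite prodrXr coefXn; congr ((nat_of_bool _)%:R).
  have zE c : q c = p (s c) + n%:Z * ((q c - p (s c)) %/ n%:Z)%Z.
    by rewrite mulrC divzK ?H //; ring.
  have z_ge0 c : 0 <= ((q c - p (s c)) %/ n%:Z)%Z.
    by have := zE c; have := hp (s c); have := hq c; nia.
  have sumE : (\sum_c `|((q c - p (s c)) %/ n%:Z)%Z|)%N%:Z =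
      \sum_c ((q c - p (s c)) %/ n%:Z)%Z.
    by rewrite -natz natr_sum; apply: eq_bigr => c _; rewrite natz gez0_abs.
  apply/eqP/andP => [e|[/eqP es /forallP eB]].
    rewrite -e PoszM in sumE.
    have [|-> eB] := perm_winding_id (G := G%:Z) ncp ncq zE.
      by rewrite -sumE -mulr_natr natz.
    by split=> //; apply/forallP => c; rewrite eB.
  apply/eqP; rewrite -eqz_nat sumE (eq_bigr (fun=> G%:Z)) => [|c _].
    by rewrite sumr_const card_ord -mulr_natr natz PoszM.
  by rewrite es perm1 (eqP (eB c)) addrAC subrr add0r mulKz.
rewrite /determinant coef_sum (bigD1 1%g) //= [X in _ + X]big1 => [|s /negbTE s1].
  under eq_bigr do rewrite mxE.
  by rewrite addr0 odd_perm1 mul1r term eqxx.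
under eq_bigr do rewrite mxE.
by rewrite -(rmorph_sign (polyC (R := F))) coefCM term s1 mulr0.
Qed.
Section Determinants.
Variables (F : fieldType) (m n : nat) (x : 'M[F]_(m, n)).
Hypothesis m_gt0 : (0 < m)%N.

(* Dual Jacobi-Trudi for loop skew Schur functions. *)
Lemma loop_schur_det k (sh : skew_shape) (L M : 'I_k -> nat) (r : int) :
  (forall c, (M c <= L c)%N) ->
  (forall c c' : 'I_k, (c <= c')%N -> (M c' <= M c)%N) ->
  (forall c c' : 'I_k, (c <= c')%N -> (L c' <= L c)%N) ->
  (forall a b, ((a, b) \in skew_cells sh) <->
     exists c : 'I_k, b = c.+1 /\ (M c < a <= L c)%N) ->
  loop_schur x r sh =
  \det (\matrix_(i, j) entry x m (r + (M i)%:Z - i%:Z) (r - m%:Z + (L j)%:Z - j%:Z)).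
Proof.
move=> le_ML monoM monoL cellsP.
(* With this width distinct translates of the shape share no row, so cylindric means semistandard.
   Moreover positions moved by [N] leave the band of [entry], so the wrap factor is 0. *)
pose B := (\sum_(c < k) L c)%N; pose N := (k + m + B)%N.
have leB c : (L c <= B)%N by rewrite /B (bigD1 c) //= leq_addr.
have lekN : (k <= N)%N by rewrite /N -addnA leq_addr.
have Mcyl : cyl_heights N M.
  split=> // c c'; have := le_ML c; have := leB c; rewrite /N; lia.
have Lcyl : cyl_heights N L.
  split=> // c c'; have := leB c; rewrite /N; lia.
pose q (c : 'I_k) : int := r - m%:Z + (L c)%:Z - c%:Z.
pose p (c : 'I_k) : int := r + (M c)%:Z - c%:Z.
have ncp : noncrossing N p.
  by apply/(@noncrossing_heights N k M r) => // c; rewrite /p; lia.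
have ncq : noncrossing N q.
  by apply/(@noncrossing_heights N k L (r - m%:Z)) => // c; rewrite /q; lia.
have cellE (s : cell sh) : (0 < cell_col s <= k)%N /\ (0 < cell_row s <= B)%N.
  have /cellsP[c [ec h]] : (cell_row s, cell_col s) \in skew_cells sh.
    by rewrite -surjective_pairing; apply: ssvalP.
  by have := leB c; have := ltn_ord c; rewrite ec; lia.
transitivity (\sum_(T : filling sh m | `[< cylindric_tableau N k T >]) weight x r T).
  apply: eq_bigl => T; apply/forallP/asboolP => [ss d d' s s'|cyl s].
    have [h1 h2] := cellE s; have [h3 h4] := cellE s'.
    have /forallP/(_ s')/andP[/implyP hrow /implyP hcol] := ss s.
    rewrite /translate_row /translate_col /N; split=> [er lec|ec ltr].
      have ed : d = d' by nia.
      by apply: hrow; rewrite ed in er lec; apply/andP; split; [apply/eqP|]; lia.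
    have ed : d = d' by nia.
    by apply: hcol; rewrite ed in ec ltr; apply/andP; split; [apply/eqP|]; lia.
  apply/forallP => s'; have := cyl 0 0 s s'.
  rewrite /translate_row /translate_col !mul0r !addr0 => -[hrow hcol].
  apply/andP; split; apply/implyP => /andP[/eqP e h].
    by apply: hrow; rewrite ?e.
  by apply: hcol; rewrite ?e.
rewrite (cyl_tableaux_chains _ _ m_gt0 lekN le_ML Mcyl Lcyl cellsP) -/q.
rewrite -det_tr.
have -> : (\matrix_(i, j) entry x m (r + (M i)%:Z - i%:Z)
             (r - m%:Z + (L j)%:Z - j%:Z))^T =
  \matrix_(c, i) whirl (row_var x) (fun b => (p i == b)%:R) m (q c).
  by apply/matrixP => c i; rewrite !mxE.
rewrite (@det_whirl _ _ N k 0 (r - m%:Z - k%:Z + 1)) //; first last.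
- by move=> c; rewrite /q; have := ltn_ord c; lia.
- move=> v i b leb; rewrite mul0r -/(entry x v (p i) _) entry_gt //.
  by rewrite /p; have := le_ML i; have := leB i; move: leb; rewrite /N; lia.
rewrite big_mkcondr /=; apply: eq_bigr => Y chY.
rewrite (det_indicator _ ncp); last by have /forallP/(_ ord0) := chY.
by case: ifP; rewrite ?mulr1 ?mulr0.
Qed.

(** The minor of M(t) on the last [k] rows, listed downwards from [n] because the column positions
    [q] decrease. *)
Definition fdet k (q : 'I_k -> int) : {poly F} :=
  \det (\matrix_(c, r) folded x m (n%:Z - r%:Z) (q c)).

End Determinants.

(** * Partitions and the removal operation *)

Lemma part_col_anti lam b b' : (b <= b')%N -> (part_col lam b' <= part_col lam b)%N.
Proof. by move=> le; apply: sub_count => l /=; apply: leq_trans. Qed.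

Lemma part_col_row lam a b : sorted geq lam -> (0 < a)%N -> (0 < b)%N ->
  (b <= part_row lam a)%N = (a <= part_col lam b)%N.
Proof.
move=> + + b_gt0; elim: lam a => [|l lam IH] [|a] //=.
  by move=> _ _; rewrite /part_row nth_nil leqNgt b_gt0.
rewrite /part_row /= => pth _; have srt := path_sorted pth.
have /allP min : all (geq l) lam by apply: (order_path_min _ pth) => u v w /= h1 /leq_trans; apply.
rewrite /part_col /= -/(part_col lam b); case: (leqP b l) => [le|lt].
  by case: a => [|a] //=; rewrite add1n ltnS -IH.
rewrite add0n; have -> : part_col lam b = 0%N.
  apply/eqP; rewrite eqn0Ngt -has_count; apply/hasPn => l' /min /= le.
  by rewrite -ltnNge (leq_ltn_trans le lt).
case: a => [|a] /=; first by rewrite leqNgt lt.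
apply/negbTE; rewrite -ltnNge; case: (ltnP a (size lam)) => h.
  by apply: leq_ltn_trans lt; apply/min/mem_nth.
by rewrite nth_default.
Qed.

Lemma mem_skew_cells k lam mu a b :
  sorted geq lam -> sorted geq mu -> (part_row lam 1 <= k)%N ->
  ((a, b) \in skew_cells (lam, mu)) <->
  exists c : 'I_k, b = c.+1 /\ (part_col mu c.+1 < a <= part_col lam c.+1)%N.
Proof.
move=> slam smu lek; split.
  case/allpairsPdep => a' [b' [+ + [-> ->]]]; rewrite !mem_iota /= => /andP[a0 ha].
  case/andP => lo hi; have b0 : (0 < b')%N by apply: leq_ltn_trans lo.
  have hi' : (b' <= part_row lam a')%N by lia.
  have lt : (b'.-1 < k)%N.
    rewrite prednK //; apply: leq_trans lek; rewrite part_col_row //.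
    by apply: (leq_trans (a0)); rewrite -part_col_row.
  exists (Ordinal lt); rewrite /= prednK //; split=> //.
  by rewrite ltnNge -!part_col_row // -ltnNge lo.
case=> c [-> /andP[lo hi]]; have a0 : (0 < a)%N by apply: leq_ltn_trans lo.
rewrite ltnNge -part_col_row // -ltnNge in lo.
apply/allpairsPdep; exists a, c.+1; split=> //; rewrite mem_iota.
  by rewrite a0 add1n ltnS (leq_trans hi) ?count_size.
by rewrite -part_col_row // in hi; rewrite /= lo; lia.
Qed.

Lemma part_col_nseq p l b : part_col (nseq p l) b = ((b <= l) * p)%N.
Proof. by rewrite /part_col count_nseq. Qed.

Lemma sorted_geq_nseq p l : sorted geq (nseq p l).
Proof.
apply/(sortedP 0%N) => j; rewrite size_nseq => lt.
by rewrite !nth_nseq lt (ltnW lt) /geq /= leqnn.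
Qed.

Lemma part_row_anti lam a : sorted geq lam -> (part_row lam a <= part_row lam 1)%N.
Proof.
case: lam => [|l lam] pth; first by rewrite /part_row !nth_nil.
case: a => [|[|a]] //; rewrite /part_row /=.
have /allP min : all (geq l) lam by apply: (order_path_min _ pth) => u v w /= h1 /leq_trans; apply.
case: (ltnP a (size lam)) => h; last by rewrite nth_default.
exact/min/mem_nth.
Qed.

Lemma part_col_conj s b : sorted geq s -> (0 < b)%N ->
  part_col (part_conj s) b = part_row s b.
Proof.
move=> srt b0; rewrite /part_col /part_conj count_map.
rewrite (@eq_in_count _ _ (fun a => a <= part_row s b)%N) => [|a]; last first.
  by rewrite mem_iota => /andP[a0 _] /=; rewrite part_col_row.
have := part_row_anti b srt; set t := part_row s b; set l := part_row s 1.
clearbody t l; move=> le.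
rewrite -(subnKC le) iotaD count_cat [X in (X + _)%N](_ : _ = t); last first.
  rewrite -[RHS](size_iota 1 t); apply/eqP; rewrite -all_count.
  by apply/allP => a; rewrite mem_iota add1n ltnS => /andP[].
rewrite [X in (_ + X)%N](_ : _ = 0%N) ?addn0 //; apply/eqP.
rewrite eqn0Ngt -has_count; apply/hasPn => a; rewrite mem_iota.
by rewrite -ltnNge; lia.
Qed.

Lemma sorted_part_conj s : sorted geq (part_conj s).
Proof.
apply/(sortedP 0%N) => i; rewrite size_map size_iota => lt.
rewrite !(nth_map 0%N) ?size_iota ?(ltnW lt) // !nth_iota ?(ltnW lt) //.
exact: part_col_anti.
Qed.

Lemma part_row_conj s : (part_row (part_conj s) 1 <= size s)%N.
Proof.
rewrite /part_row /part_conj; case: (part_row s 1) => // r.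
exact: count_size.
Qed.

(** Column lengths are the coordinates in which removal becomes a rotation of positions. *)
Lemma flatP n k lam : (k <= n)%N -> (0 < k)%N ->
  sorted geq lam -> (part_row lam 1 <= k)%N ->
  cyl_heights n (fun c : 'I_k => part_col lam c.+1) ->
  if (n - k + 1 <= part_col lam 1)%N then
    exists lam', [/\ flat n k lam = Some lam', sorted geq lam',
      (part_row lam' 1 <= k)%N &
      forall c : 'I_k, part_col lam' c.+1 =
        if (c.+1 < k)%N then (part_col lam c.+2 - 1)%N
        else (part_col lam 1 - (n - k + 1))%N]
  else flat n k lam = None.
Proof.
move=> lekn k0 srt row1 [mono cyc].
have ltk : (k.-1 < k)%N by rewrite prednK.
have cyl : cylindric n k lam.
  rewrite /cylindric srt row1 /=; have := cyc (Ordinal k0) (Ordinal ltk).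
  by rewrite /= prednK //; lia.
rewrite /flat cyl /=; case: ifP => le1; last by rewrite le1.
set s := rcons _ _; exists (part_conj s).
have szs : size s = k by rewrite size_rcons size_map size_iota; lia.
have nths c : (c < k)%N -> nth 0%N s c =
    if (c.+1 < k)%N then (part_col lam c.+2 - 1)%N
    else (part_col lam 1 - (n - k + 1))%N.
  move=> ltc; rewrite nth_rcons size_map size_iota; case: ltnP => h.
    by rewrite (nth_map 0%N) ?size_iota // nth_iota // add2n; have -> : (c.+1 < k)%N by lia.
  have -> : (c.+1 < k)%N = false by lia.
  by have -> : c == (k - 1)%N by lia.
have srts : sorted geq s.
  apply/(sortedP 0%N) => c; rewrite szs => lt; rewrite !nths ?(ltnW lt) // lt.
  case: ltnP => h; first by apply: leq_sub2r; apply: part_col_anti.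
  (* The cylindric bound between the first and the last column keeps the moved column at most as
     long as its new left neighbour. *)
  have lt0c : (c.+1 < k)%N by [].
  by have := cyc (Ordinal k0) (Ordinal lt0c); rewrite /geq /=; lia.
split=> //; first by rewrite le1.
  exact: sorted_part_conj.
  by rewrite -[X in (_ <= X)%N]szs; apply: part_row_conj.
by move=> c; rewrite part_col_conj // /part_row /= nths.
Qed.

(** * Coefficients of the minor and rotation of its column positions *)

Section Rotation.
Variables (F : fieldType) (m n : nat) (x : 'M[F]_(m, n)).
Hypothesis n_gt0 : (0 < n)%N.

(** The end positions are those of the empty partition, moved by [G] full turns. *)
Lemma coef_fdet k (q : 'I_k -> int) (G : nat) : (k <= n)%N ->
  noncrossing n q -> (forall c, 1 <= q c) ->
  (fdet x q)`_(G * k) =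
  \sum_(Y : {ffun 'I_m -> {set 'I_k}} | chain n q Y &&
     [forall c, height_pos q Y 0 c == n%:Z - c%:Z + n%:Z * G%:Z])
   chain_weight (row_var x) q Y.
Proof.
move=> lekn ncq hq; rewrite /fdet /folded.
rewrite (@det_whirl _ _ n k 'X 1 (fun r => unfolded0 F n (n%:Z - r%:Z))) //; last first.
  move=> v r b leb; rewrite -!/(folded x v _ _) folded_wrap //.
  by lia.
rewrite coef_sum big_mkcondr /=; apply: eq_bigr => Y chY.
have -> : chain_weight (fun v b => (row_var x v b)%:P) q Y =
    (chain_weight (row_var x) q Y)%:P.
  rewrite /chain_weight rmorph_prod; apply: eq_bigr => u _.
  by rewrite rmorph_prod.
rewrite coefCM coef_det_unfolded0 //; first by case: ifP; rewrite ?mulr1 ?mulr0.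
- apply/(@noncrossing_heights n k (fun c => 0%N) n%:Z) => // c.
  by rewrite addr0.
- by have /forallP/(_ ord0) := chY.
- by move=> c; lia.
- by move=> c; apply: le_trans (hq c) _; rewrite /height_pos lerDl.
Qed.

Lemma coef_fdet_cyl k (q : 'I_k -> int) (G : nat) lam : (0 < m)%N -> (k <= n)%N ->
  sorted geq lam -> (part_row lam 1 <= k)%N ->
  cyl_heights n (fun c : 'I_k => part_col lam c.+1) ->
  (forall c, 1 <= q c) ->
  (forall c, q c = n%:Z + n%:Z * G%:Z - m%:Z + (part_col lam c.+1)%:Z - c%:Z) ->
  (fdet x q)`_(G * k) = cyl_loop_schur x k n%:Z (lam, [::]).
Proof.
move=> m_gt0 lekn srt row1 cyl hq eq_q.
have ncq : noncrossing n q.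
  apply/(noncrossing_heights (C := n%:Z + n%:Z * G%:Z - m%:Z) lekn) => [c|].
    by rewrite eq_q addrAC.
  exact: cyl.
have qE : q = fun c => n%:Z + n%:Z * G%:Z - m%:Z + (part_col lam c.+1)%:Z - c%:Z.
  by apply/funext.
rewrite coef_fdet // /cyl_loop_schur.
transitivity (\sum_(T : filling (lam, [::]) m | `[< cylindric_tableau n k T >])
    weight x (n%:Z + n%:Z * G%:Z) T); last first.
  apply: eq_bigr => T _; apply: eq_bigr => s _.
  by rewrite addrA loop_var_period.
rewrite (@cyl_tableaux_chains _ m n x n k _ (fun c => part_col lam c.+1)
           (fun=> 0%N) (n%:Z + n%:Z * G%:Z)) //; last first.
  by move=> a b; apply: mem_skew_cells.
rewrite -qE; apply: eq_bigl => Y; congr andb; apply: eq_forallb => c.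
by rewrite addr0 addrAC.
Qed.

(** A path climbs at most [m] steps and cannot reach its end from so low a start. This is the case
    of a negative column length. *)
Lemma coef_fdet_negative k (q : 'I_k -> int) (G : nat) c : (k <= n)%N ->
  noncrossing n q -> (forall c, 1 <= q c) ->
  q c < n%:Z + n%:Z * G%:Z - m%:Z - c%:Z -> (fdet x q)`_(G * k) = 0.
Proof.
move=> lekn ncq hq lt; rewrite coef_fdet // big1 // => Y /andP[_ /forallP/(_ c)/eqP].
rewrite /height_pos; set A := (\sum_(u < m | _) _)%N.
have leA : (A <= m)%N.
  rewrite -[X in (_ <= X)%N]card_ord -sum1_card /A big_mkcond /=.
  by apply: leq_sum => u _; case: (_ \notin _).
by lia.
Qed.

Lemma fdet_shift k (q : 'I_k -> int) (G : nat) : (forall c, 1 <= q c) ->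
  fdet x (fun c => q c + n%:Z * G%:Z) = 'X^(G * k) * fdet x q.
Proof.
move=> hq; rewrite /fdet.
have -> : 'X^(G * k) = \prod_(c < k) ('X^G : {poly F}).
  by rewrite prodr_const card_ord exprM.
rewrite -det_row_scale; congr (\det _); apply/matrixP => c r; rewrite !mxE.
elim: G => [|G IH]; first by rewrite mulr0 addr0 mul1r.
rewrite -addn1 PoszD mulrDr mulr1 addrA folded_wrap //; first by rewrite IH exprD expr1 mulrA (mulrC 'X).
  by lia.
by have := hq c; lia.
Qed.

(** The decreasing extension by [q (c + k.+1) = q c - n], read from index 1 on. *)
Definition rotate_pos k (q : 'I_k.+1 -> int) (c : 'I_k.+1) : int :=
  if unlift ord_max c is Some c' then q (lift ord0 c') else q ord0 - n%:Z.

Lemma rotate_pos_lift k (q : 'I_k.+1 -> int) c :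
  rotate_pos q (lift ord_max c) = q (lift ord0 c).
Proof. by rewrite /rotate_pos liftK. Qed.

Lemma rotate_pos_max k (q : 'I_k.+1 -> int) :
  rotate_pos q ord_max = q ord0 - n%:Z.
Proof. by rewrite /rotate_pos unlift_none. Qed.

Lemma noncrossing_rotate k (q : 'I_k.+1 -> int) : noncrossing n q ->
  noncrossing n (rotate_pos q).
Proof.
move=> /noncrossingP H; apply/noncrossingP => c c'.
case: (unliftP ord_max c') => [d'|] ->; case: (unliftP ord_max c) => [d|] ->.
- rewrite !lift_max => lt.
  by rewrite !rotate_pos_lift; apply: H; rewrite !lift0.
- rewrite lift_max => lt; have := ltn_ord d'; rewrite ltnNge; case/negP; exact: ltnW lt.
- rewrite rotate_pos_lift rotate_pos_max => _.
  have : ((ord0 : 'I_k.+1) < lift ord0 d)%N by [].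
  by move/H => /andP[h1 h2]; rewrite subrK ltrBlDr h1 h2.
by rewrite ltnn.
Qed.

Lemma fdet_rotate k (q : 'I_k.+1 -> int) : (forall c, 1 <= rotate_pos q c) ->
  'X * fdet x (rotate_pos q) = (-1) ^+ k * fdet x q.
Proof.
move=> hq; rewrite /fdet.
pose s : 'S_k.+1 := lift_perm ord_max ord0 1.
pose A := \matrix_(c, r) folded x m (n%:Z - (r : 'I_k.+1)%:Z) (q c).
have -> : 'X = \prod_(c < k.+1) (if c == ord_max then 'X else 1 : {poly F}).
  by rewrite -big_mkcond big_pred1_eq.
rewrite -det_row_scale.
have -> : (-1) ^+ k = (-1) ^+ s :> {poly F}.
  by rewrite odd_lift_perm odd_perm1 addbF /= addbF signr_odd.
rewrite -det_perm -det_mulmx -row_permE; congr (\det _).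
apply/matrixP => c r; rewrite !mxE; case: (unliftP ord_max c) => [c'|] ->.
  by rewrite eq_sym (negbTE (neq_lift _ _)) mul1r lift_perm_lift perm1 rotate_pos_lift.
rewrite eqxx lift_perm_id -folded_wrap //; first by rewrite rotate_pos_max subrK.
  by lia.
Qed.

End Rotation.

(** * Expansion of the minor in powers of t *)

Section Expansion.
Variables (F : fieldType) (m n i : nat) (x : 'M[F]_(m, n)).
Hypothesis m_gt0 : (0 < m)%N.
Hypothesis n_gt0 : (0 < n)%N.
Hypothesis i_gt0 : (0 < i)%N.
Hypothesis i_lem : (i <= m + 1)%N.
Hypothesis i_len : (i <= n)%N.

Local Notation k := (n - i).+1.
Let q0 (c : 'I_k) : int := k%:Z - c%:Z.
Let q d := iter d (@rotate_pos n (n - i)) q0.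
(* The column lengths of the [d]-th removal of the rectangle, which may become
   negative, in which case the removal is undefined. *)
Let col d (c : 'I_k) : int := q d c - n%:Z + m%:Z + c%:Z.

Let lekn : (k <= n)%N.
Proof. by lia. Qed.

Let ncq d : noncrossing n (q d).
Proof.
elim: d => [|d]; last exact: noncrossing_rotate.
apply/(@noncrossing_heights n k (fun=> 0%N) k%:Z _ lekn) => [c|//].
by rewrite addr0.
Qed.

Let rotate_shift (p : 'I_k -> int) (z : int) c :
  rotate_pos n (fun c => p c + z) c = rotate_pos n p c + z.
Proof. by rewrite /rotate_pos; case: unlift => [c'|] //; rewrite addrAC. Qed.

Let iter_rotate_shift (p : 'I_k -> int) (z : int) d :
  iter d (@rotate_pos n (n - i)) (fun c => p c + z) =
  fun c => iter d (@rotate_pos n (n - i)) p c + z.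
Proof.
elim: d => [|d IH] //=; rewrite IH; apply/funext => c; exact: rotate_shift.
Qed.

Let q_ge d c : 1 - n%:Z * d%:Z <= q d c.
Proof.
elim: d c => [|d IH] c; first by have := ltn_ord c; rewrite /q /= /q0; lia.
rewrite /q iterS -/(q d) /rotate_pos; case: unlift => [c'|].
  by have := IH (lift ord0 c'); nia.
by have := IH ord0; nia.
Qed.

Let fdet_iter_rotate (p : 'I_k -> int) d :
  (forall e c, (e <= d)%N -> 1 <= iter e (@rotate_pos n (n - i)) p c) ->
  'X^d * fdet x (iter d (@rotate_pos n (n - i)) p) = (-1) ^+ ((n - i) * d) * fdet x p.
Proof.
elim: d => [|d IH] H; first by rewrite muln0 !mul1r.
rewrite exprSr -mulrA iterS fdet_rotate //; last by move=> c; apply: (H d.+1).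
rewrite mulrCA IH => [|e c le]; last by apply: H; rewrite ltnW.
by rewrite mulrA -exprD mulnS.
Qed.

(** Translating by [n * d] keeps all positions at least 1 during the rotations and multiplies the
    minor by ['X^(d * k)]; the rotations divide it by ['X^d] up to sign. Comparing degree
    [d * k + d] gives the claim. *)
Let coef_fdet_rotate d :
  (fdet x q0)`_d =
  (-1) ^+ ((n - i) * d) * (fdet x (fun c => q d c + n%:Z * d%:Z))`_(d * k).
Proof.
have q0_ge c : 1 <= q0 c by rewrite /q0; have := ltn_ord c; lia.
have E : 'X^d * fdet x (fun c => q d c + n%:Z * d%:Z) =
    (-1) ^+ ((n - i) * d) * ('X^(d * k) * fdet x q0).
  rewrite -fdet_shift // -fdet_iter_rotate ?iter_rotate_shift //.
  move=> e c le; rewrite iter_rotate_shift -/(q e).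
  by have := q_ge e c; nia.
have := congr1 (fun p : {poly F} => p`_(d * k + d)) E.
rewrite coefXnM ifN ?addnK; last by rewrite -leqNgt leq_addl.
move=> ->; rewrite -(rmorph_sign (polyC (R := F))) coefCM coefXnM ifN; last by rewrite -leqNgt leq_addr.
by rewrite addKn signrMK.
Qed.

Let col0 c : col 0 c = m%:Z - i%:Z + 1.
Proof. by rewrite /col /q /= /q0; lia. Qed.

Let colS_lift d (c : 'I_(n - i)) :
  col d.+1 (lift ord_max c) = col d (lift ord0 c) - 1.
Proof.
rewrite /col /q iterS -/(q d) rotate_pos_lift lift_max lift0; lia.
Qed.

Let colS_max d : col d.+1 ord_max = col d ord0 - i%:Z.
Proof.
rewrite /col /q iterS -/(q d) rotate_pos_max /=; lia.
Qed.

(** The first rotation creates a column of length [m - 2 * i + 1], and each later rotation shortens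
    it by 1 or [i]. Hence the last index of the sum: beyond it some length is negative. *)
Let col_tail d : (0 < d)%N -> exists c, col d c <= m%:Z - 2 * i%:Z + 2 - d%:Z.
Proof.
elim: d => [//|[_ _|d IH _]].
  by exists ord_max; rewrite colS_max col0; lia.
have [//|c hc] := IH; case: (unliftP ord0 c) hc => [c'|] -> hc.
  by exists (lift ord_max c'); rewrite colS_lift; lia.
by exists ord_max; rewrite colS_max; lia.
Qed.

(** Undefinedness persists because a negative length only decreases under further rotation. *)
Let removal_spec d :
  match removal_iter n k d (nseq (m + 1 - i) k, [::]) with
  | Some sh => [/\ sh.2 = [::], sorted geq sh.1, (part_row sh.1 1 <= k)%N &
                forall c : 'I_k, (part_col sh.1 c.+1)%:Z = col d c]
  | None => exists c, col d c < 0
  end.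
Proof.
elim: d => [|d].
  split=> //= [||c].
  - exact: sorted_geq_nseq.
  - by rewrite /part_row nth_nseq; case: ifP.
  by rewrite part_col_nseq ltn_ord mul1n col0; lia.
rewrite /removal_iter iterS -/(removal_iter _ _ d _).
case: removal_iter => [[lam mu] /= [-> srt row1 colE]|/= [c hc]]; last first.
  case: (unliftP ord0 c) hc => [c'|] -> hc.
    by exists (lift ord_max c'); rewrite colS_lift; lia.
  by exists ord_max; rewrite colS_max; lia.
have cyl : cyl_heights n (fun c : 'I_k => part_col lam c.+1).
  apply/(@noncrossing_heights _ _ _ (n%:Z - m%:Z) (q d) lekn) => [c|//].
  by have := colE c; rewrite /col; lia.
have nki : (n - k + 1)%N = i by lia.
have := flatP lekn (ltn0Sn _) srt row1 cyl; rewrite nki /removal /=.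
case: ifP => [lei [lam' [-> srt' row1' colE']]|lti ->].
  split=> // c; rewrite colE'.
  case: (unliftP ord_max c) => [c'|] ->.
    rewrite colS_lift lift_max -colE lift0 ltnS ltn_ord.
    (* A first column of length at least [i] makes all columns nonempty by the cylindric bound, so
       subtracting 1 is exact. *)
    have [mono cyc] := cyl; have := cyc ord0 (lift ord0 c'); rewrite lift0 /=.
    by lia.
  by rewrite colS_max -colE /= ltnn; lia.
exists ord_max; rewrite colS_max -colE /=; lia.
Qed.

Lemma fdet_expansion :
  fdet x q0 = \sum_(0 <= d < (m + 2 - 2 * i).+1)
    ((-1) ^+ (n - i) *: 'X) ^+ d *
    (cyl_loop_schur_opt x k n%:Z
       (removal_iter n k d (nseq (m + 1 - i) k, [::])))%:P.
Proof.
have coefE d : (fdet x q0)`_d = (-1) ^+ ((n - i) * d) *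
    cyl_loop_schur_opt x k n%:Z (removal_iter n k d (nseq (m + 1 - i) k, [::])).
  rewrite coef_fdet_rotate; congr (_ * _).
  set p := fun c => _; have p_ge c : 1 <= p c by rewrite /p; have := q_ge d c; nia.
  have ncp : noncrossing n p.
    apply/noncrossingP => c c' lt; have /noncrossingP/(_ c c' lt) := ncq d.
    by rewrite /p; lia.
  have := removal_spec d; case: removal_iter => [[lam mu] [/= -> srt row1 colE]|[c hc]].
    rewrite (coef_fdet_cyl x n_gt0 m_gt0 lekn srt row1) //.
      apply/(@noncrossing_heights _ _ _ (n%:Z - m%:Z) (q d) lekn) => [c|//].
      by have := colE c; rewrite /col; lia.
    by move=> c; have := colE c; rewrite /p /col; lia.
  apply: (@coef_fdet_negative _ _ _ x n_gt0 _ _ _ c) => //.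
  by move: hc; rewrite /p /col; lia.
apply/polyP => d; rewrite [RHS]coef_sum.
have E j : (((-1) ^+ (n - i) *: 'X) ^+ j * (cyl_loop_schur_opt x k n%:Z
       (removal_iter n k j (nseq (m + 1 - i) k, [::])))%:P)`_d =
    if j == d then (fdet x q0)`_d else 0.
  rewrite coefMC exprZn coefZ coefXn -exprM eq_sym.
  by case: eqP => [->|_]; rewrite ?coefE ?mulr1 ?mulr0 ?mul0r.
under eq_bigr do rewrite E.
rewrite -big_mkcond big_mkord /=.
case: (ltnP d (m + 2 - 2 * i).+1) => [lt|ge].
  by rewrite (big_pred1 (Ordinal lt)).
rewrite big_pred0 => [|j]; last by have := ltn_ord j; lia.
have d_gt0 : (0 < d)%N by lia.
have [c hc] := col_tail d_gt0.
rewrite coef_fdet_rotate.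
rewrite (@coef_fdet_negative _ _ _ x n_gt0 _ _ _ c) ?mulr0 //.
- apply/noncrossingP => c1 c2 lt; have /noncrossingP/(_ c1 c2 lt) := ncq d.
  by lia.
- by move=> c1; have := q_ge d c1; nia.
by move: hc; rewrite /col; lia.
Qed.

End Expansion.

(** * Reduction by unitriangular matrices *)

(** Indices in [nat] allow minors with different offsets and sizes to be compared without casts. *)
Definition sqdet (R : comNzRingType) (k : nat) (f : nat -> nat -> R) : R :=
  \det (\matrix_(i < k, j < k) f i j).

Lemma eq_sqdet (R : comNzRingType) k k' (f g : nat -> nat -> R) : k = k' ->
  (forall i j, (i < k)%N -> (j < k)%N -> f i j = g i j) -> sqdet k f = sqdet k' g.
Proof.
by move=> <- e; congr (\det _); apply/matrixP => i j; rewrite !mxE e.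
Qed.

Lemma sqdet_rev (R : comNzRingType) k (f : nat -> nat -> R) :
  sqdet k f = sqdet k (fun i j => f (k - i.+1)%N (k - j.+1)%N).
Proof.
pose s := perm (@rev_ord_inj k); rewrite /sqdet.
set A := \matrix_(i, j) f i j.
have -> : \matrix_(i < k, j < k) f (k - i.+1)%N (k - j.+1)%N =
    row_perm s (col_perm s A).
  by apply/matrixP => i j; rewrite !mxE !permE.
rewrite row_permE col_permE !det_mulmx !det_perm odd_permV mulrC -mulrA.
by rewrite -expr2 sqrr_sign mulr1.
Qed.

Lemma sqdet_upper_unitriangular (R : comNzRingType) k (f : nat -> nat -> R) :
  (forall i, (i < k)%N -> f i i = 1) ->
  (forall i j, (j < i < k)%N -> f i j = 0) -> sqdet k f = 1.
Proof.
move=> f1 f0; rewrite /sqdet -det_tr det_trig.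
  by rewrite big1 // => i _; rewrite !mxE f1.
by apply/is_trig_mxP => i j lt; rewrite !mxE f0 // lt ltn_ord.
Qed.

Lemma left_solve (F : fieldType) k (f : nat -> nat -> F) (b : nat -> F) :
  sqdet k f != 0 ->
  exists u : nat -> F, forall c, (c < k)%N -> b c + \sum_(r < k) u r * f r c = 0.
Proof.
move=> nz; pose A := \matrix_(i < k, j < k) f i j.
have unitA : A \in unitmx by rewrite unitmxE unitfE.
pose w := - (\row_(j < k) b j) *m invmx A.
exists (fun r => if insub r is Some r' then w 0 r' else 0) => c lt.
have : (w *m A) 0 (Ordinal lt) = - b c by rewrite /w mulmxKV // !mxE.
rewrite mxE => e; apply/eqP; rewrite addrC addr_eq0 -e; apply/eqP.
by apply: eq_bigr => r _; rewrite valK [A _ _]mxE.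
Qed.

Lemma right_solve (F : fieldType) k (f : nat -> nat -> F) (b : nat -> F) :
  sqdet k f != 0 ->
  exists v : nat -> F, forall r, (r < k)%N -> b r + \sum_(c < k) f r c * v c = 0.
Proof.
rewrite /sqdet -det_tr => nz.
have [|v hv] := @left_solve F k (fun i j => f j i) b.
  by move: nz; congr (\det _ != 0); apply/matrixP => i j; rewrite !mxE.
exists v => r lt; rewrite -[RHS](hv r lt); congr (_ + _).
by apply: eq_bigr => c _; rewrite mulrC.
Qed.

Definition upper_unitri (R : comNzRingType) (U : nat -> nat -> R) : Prop :=
  (forall a, U a a = 1) /\ (forall a b, (b < a)%N -> U a b = 0).

Definition sandwich (R : comNzRingType) n (U V g : nat -> nat -> R) (a c : nat) : R :=
  \sum_(b < n) \sum_(b' < n) U a b * g b b' * V b' c.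

(** [U] adds to a row only rows below it and [V] adds to a column only columns to its left, so on
    the last rows and first columns both act by unitriangular blocks. *)
Lemma sqdet_sandwich (R : comNzRingType) n s k (U V g : nat -> nat -> R) :
  upper_unitri U -> upper_unitri V -> (s + k = n)%N ->
  sqdet k (fun r c => sandwich n U V g (s + r) c) = sqdet k (fun r c => g (s + r)%N c).
Proof.
move=> [U1 U0] [V1 V0] en.
pose U' := \matrix_(r < k, r' < k) U (s + r)%N (s + r')%N.
pose V' := \matrix_(c < k, c' < k) V c c'.
pose G := \matrix_(r < k, c < k) g (s + r)%N c.
have dU : \det U' = 1.
  apply: (@sqdet_upper_unitriangular _ _ (fun r r' => U (s + r) (s + r'))%N) => [r _|r r' /andP[lt _]].
    exact: U1.
  by rewrite U0 ?ltn_add2l.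
have dV : \det V' = 1.
  apply: (@sqdet_upper_unitriangular _ _ V) => [r _|r r' /andP[lt _]]; first exact: V1.
  exact: V0.
rewrite /sqdet -/G; have -> : \det G = \det (U' *m G *m V').
  by rewrite !det_mulmx dU dV mul1r mulr1.
congr (\det _); apply/matrixP => r c; rewrite /sandwich !mxE.
under [RHS]eq_bigr do rewrite mxE mulr_suml.
rewrite exchange_big /=.
have lekn : (k <= n)%N by rewrite -en leq_addl.
rewrite -(big_mkord xpredT (fun b' => \sum_(b < n) U (s + r)%N b * g b b' * V b' c)).
rewrite (big_cat_nat _ lekn) //= [X in _ + X]big_nat_cond [X in _ + X]big1 ?addr0; last first.
  move=> b' /andP[/andP[le _] _]; apply: big1 => b _.
  by rewrite V0 ?mulr0 // (leq_trans (ltn_ord c)).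
rewrite big_mkord; apply: eq_bigr => c' _.
rewrite -(big_mkord xpredT (fun b => U (s + r)%N b * g b c' * V c' c)).
have lesn : (s <= n)%N by rewrite -en leq_addr.
rewrite (big_cat_nat _ lesn) //= big_nat_cond [X in X + _]big1 ?add0r; last first.
  by move=> b /andP[/andP[_ lt] _]; rewrite U0 ?mul0r // (leq_trans lt) ?leq_addr.
rewrite -[in X in \sum_(X <= _ < _) _](add0n s) big_addn -en addKn big_mkord.
by apply: eq_bigr => r' _; rewrite !mxE (addnC r' s).
Qed.

Lemma sum_row_op (R : comNzRingType) n a (u : nat -> R) (h : nat -> R) : (a < n)%N ->
  \sum_(b < n) (if a == b :> nat then 1 else if (a < b)%N then u (b - a.+1)%N else 0) * h b =
  h a + \sum_(r < n - a.+1) u r * h (a.+1 + r)%N.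
Proof.
move=> lt.
rewrite -(big_mkord xpredT (fun b => (if a == b then 1 else
  if (a < b)%N then u (b - a.+1)%N else 0) * h b)).
rewrite (big_cat_nat _ (ltnW lt)) //= big_nat_cond [X in X + _]big1 ?add0r; last first.
  move=> b /andP[/andP[_ ltb] _]; rewrite gtn_eqF // ltnNge ltnW ?mul0r //.
rewrite big_ltn // eqxx mul1r; congr (_ + _).
rewrite -[in X in \sum_(X <= _ < _) _](add0n a.+1) big_addn big_mkord.
apply: eq_bigr => r _; have lt' : (a < r + a.+1)%N by rewrite addnS ltnS leq_addl.
by rewrite ltn_eqF // lt' addnK addnC.
Qed.

Lemma sum_col_op (R : comNzRingType) n c (v : nat -> R) (h : nat -> R) : (c < n)%N ->
  \sum_(b < n) h b * (if b == c :> nat then 1 else if (b < c)%N then v b else 0) =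
  h c + \sum_(b < c) h b * v b.
Proof.
move=> lt.
rewrite -(big_mkord xpredT (fun b => h b * (if b == c then 1 else
  if (b < c)%N then v b else 0))).
rewrite (big_cat_nat _ lt) //= [X in _ + X]big_nat_cond [X in _ + X]big1 ?addr0; last first.
  by move=> b /andP[/andP[ltb _] _]; rewrite gtn_eqF // ltnNge ltnW ?mulr0.
rewrite big_nat_recr //= eqxx mulr1 addrC; congr (_ + _).
by rewrite big_mkord; apply: eq_bigr => b _; rewrite ltn_eqF ltn_ord.
Qed.

(** Column operations by [v] clear [al], row operations by [u] clear [rh], and a block triangular
    matrix remains. Its middle scalar is an entry of the reduced matrix, which thus becomes a
    quotient of minors. *)
Lemma det_bordered (R : comNzRingType) K l (A : 'M[R]_K) (al : 'cV_K) (g : 'rV_K)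
    (C : 'M_(l, K)) (e : 'M_1) (rh : 'rV_l) (ga : 'cV_l) (D : 'M_l)
    (u : 'rV_l) (v : 'cV_K) :
  al + A *m v = 0 -> rh + u *m D = 0 ->
  \det (block_mx A (row_mx al 0) (col_mx g C) (block_mx e rh ga D)) =
  \det A * (e + u *m ga + (g + u *m C) *m v) 0 0 * \det D.
Proof.
move=> hv hu.
pose Lm : 'M[R]_(K + (1 + l)) := block_mx 1%:M 0 0 (block_mx 1%:M u 0 1%:M).
pose Rm : 'M[R]_(K + (1 + l)) := block_mx 1%:M (row_mx v 0) 0 1%:M.
have dL : \det Lm = 1 by rewrite det_lblock det_ublock !det1 !mulr1.
have dR : \det Rm = 1 by rewrite det_ublock !det1 mulr1.
set W := block_mx A _ _ _.
have -> : \det W = \det (Lm *m W *m Rm).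
  by rewrite !det_mulmx dL dR mul1r mulr1.
have -> : Lm *m W *m Rm = block_mx A 0 (col_mx (g + u *m C) C)
    (block_mx (e + u *m ga + (g + u *m C) *m v) 0 (ga + C *m v) D).
  rewrite /Lm /W /Rm !mulmx_block !mul1mx !mul0mx !mulmx0 !mulmx1 !addr0 !add0r.
  rewrite mul_block_col !mul1mx mul0mx !add0r hu.
  rewrite mul_mx_row mulmx0 add_row_mx addr0 (addrC _ al) hv row_mx0.
  by rewrite mul_col_row !mulmx0 add_block_mx !add0r (addrC _ (e + _)) (addrC _ ga).
by rewrite !det_lblock mulrA [\det (_ + _ : 'M_1)]det_mx11.
Qed.

Lemma sorted_geq_nseq_cat p l p' l' : (l' <= l)%N ->
  sorted geq (nseq p l ++ nseq p' l').
Proof.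
move=> le; apply/(sortedP 0%N) => j; rewrite size_cat !size_nseq => lt.
rewrite !nth_cat !size_nseq !nth_nseq /geq /=.
by do ![case: ifP => //]; lia.
Qed.

(** * Loop Schur functions as corner and bordered minors *)

Section Reduction.
Variables (F : fieldType) (m n : nat) (x : 'M[F]_(m, n)).
Hypothesis m_gt0 : (0 < m)%N.
Hypothesis n_gt0 : (0 < n)%N.

(* The coefficient of t^d in row a+1, column c+1 of the folded matrix. *)
Definition folded_coef (d a c : nat) : F :=
  entry x m a.+1%:Z (c.+1%:Z - n%:Z * d%:Z).

Lemma folded_coef_const a c : folded_coef 0 a c = entry x m a.+1%:Z c.+1%:Z.
Proof. by rewrite /folded_coef mulr0 subr0. Qed.

Lemma shape_inv_sqdet s : (s <= minn m n)%N ->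
  shape_inv x s.+1 = sqdet (n - s)%N (fun r c => folded_coef 0 (s + r)%N c).
Proof.
move=> les; rewrite /shape_inv /=; case: ltnP => [lts|ges]; last first.
  (* At the conventional value [shape_inv = 1] the corner is empty ([s = n]) or unitriangular
     ([s = m < n]). *)
  have [e|e] : s = n \/ (s = m /\ (m < n)%N).
    by move: les ges; rewrite /minn; case: ltnP; lia.
    by rewrite e subnn /sqdet det_mx00.
  case: e => e lt; apply/esym/sqdet_upper_unitriangular => [i lti|i j /andP[ltj _]].
    by rewrite folded_coef_const entry_low //; lia.
  by rewrite folded_coef_const entry_lt //; lia.
have [eq_row eq_col] : (n - s.+1 + 1 = n - s)%N /\ (m - s.+1 + 1 = m - s)%N by lia.
rewrite eq_row eq_col; set lam := nseq _ _.
rewrite (@loop_schur_det _ m n x m_gt0 (n - s)%N (lam, [::])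
  (fun c => part_col lam c.+1) (fun=> 0%N)) //; first last.
- move=> a b; apply: (@mem_skew_cells (n - s)%N lam [::]) => //.
    exact: sorted_geq_nseq.
  by rewrite /part_row nth_nseq; case: ifP.
- by move=> c c' le; apply: part_col_anti.
rewrite -/(sqdet (n - s)%N (fun i j => entry x m (n%:Z + 0%:Z - i%:Z)
  (n%:Z - m%:Z + (part_col lam j.+1)%:Z - j%:Z))).
rewrite sqdet_rev; apply: eq_sqdet => // i j lti ltj.
rewrite folded_coef_const part_col_nseq.
have -> : ((n - s - j.+1).+1 <= n - s)%N by lia.
by congr (entry _ _ _ _); lia.
Qed.

(* The minor on rows [n-c+1, n] - nd, [a+1, n] and columns [1, c+1] - nd,
   [1, n-a-1] of the periodic matrix. *)
Definition bordered_entry (a c d i j : nat) : F :=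
  entry x m
    (if (i < c)%N then (n - c + i).+1%:Z - n%:Z * d%:Z else (a.+1 + (i - c))%N%:Z)
    (if (j <= c)%N then j.+1%:Z - n%:Z * d%:Z else (j - c)%N%:Z).

Lemma redQ_pos_sqdet a c d h : (a < n)%N -> (c < n)%N -> (0 < d)%N -> (0 < h)%N ->
  h%:Z = (m + c)%N%:Z - a%:Z - (n * d)%N%:Z ->
  redQ_pos x h a.+1 = sqdet (c + (1 + (n - a.+1)))%N (bordered_entry a c d) /
    (shape_inv x (a.+1 + 1)%N * shape_inv x (n + 1 - c)%N).
Proof.
move=> lta ltc d_gt0 h_gt0 eh; rewrite /redQ_pos.
have leND : (n <= n * d)%N by rewrite leq_pmulr.
(* The argument of the residue equals [c - n * d], so K is the column index [c]. *)
have -> : `|(((h + a.+1)%N%:Z - m%:Z - 1) %% n%:Z)%Z|%N = c.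
  have -> : (h + a.+1)%N%:Z - m%:Z - 1 = (- d%:Z) * n%:Z + c%:Z.
    by rewrite PoszD eh PoszM; lia.
  by rewrite modzMDl modz_small ?absz_nat //; lia.
congr (_ / _); set lam := _ ++ _; set mu := nseq _ _.
set k := (n - a.+1 + c + 1)%N.
have colL b : part_col lam b = ((b <= k) * (m + c - n) +
    (b <= n - a.+1) * (m - h - a.+1))%N.
  by rewrite /lam /part_col count_cat -!/(part_col _ _) !part_col_nseq.
have colM b : part_col mu b = ((b <= n - a.+1 + 1) * (m + c - n - h))%N.
  by rewrite part_col_nseq.
have slam : sorted geq lam by apply: sorted_geq_nseq_cat; rewrite /k; lia.
have smu : sorted geq mu by apply: sorted_geq_nseq.
have rlam : (part_row lam 1 <= k)%N.
  rewrite /part_row nth_cat size_nseq !nth_nseq /k.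
  by do ![case: ifP => //]; lia.
rewrite (@loop_schur_det _ m n x m_gt0 k (lam, mu)
  (fun c => part_col lam c.+1) (fun c => part_col mu c.+1)); first last.
- by move=> b b'; apply: mem_skew_cells.
- by move=> b b' le; apply: part_col_anti.
- by move=> b b' le; apply: part_col_anti.
- move=> b; rewrite colL colM ltn_ord mul1n.
  case: (b.+1 <= n - a.+1 + 1)%N; last by rewrite mul0n.
  by rewrite mul1n; lia.
rewrite -/(sqdet k (fun i j => entry x m
  ((n - a.+1 + 1)%N%:Z + (part_col mu i.+1)%:Z - i%:Z)
  ((n - a.+1 + 1)%N%:Z - m%:Z + (part_col lam j.+1)%:Z - j%:Z))).
rewrite sqdet_rev; apply: eq_sqdet => [|i j lti ltj]; first by rewrite /k; lia.
(* The reversed Jacobi-Trudi matrix and the bordered one differ by [d - 1] periods. *)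
rewrite /bordered_entry -[RHS](entry_period x m _ _ (d%:Z - 1)) colL colM.
have ed : n%:Z * (d%:Z - 1) = (n * d)%N%:Z - n%:Z by rewrite PoszM; ring.
have ed' : n%:Z * d%:Z = (n * d)%N%:Z by rewrite PoszM.
rewrite ed ed'; move: (n * d)%N leND eh {ed ed'} => ND leND eh.
rewrite /k in lti ltj *; congr (entry _ _ _ _).
  case: ltnP => h1; case: leqP => h2; rewrite ?mul0n ?mul1n; lia.
have -> : ((n - a.+1 + c + 1 - j.+1).+1 <= n - a.+1 + c + 1)%N by lia.
by case: leqP => h1; case: leqP => h2; rewrite ?mul0n ?mul1n; lia.
Qed.

End Reduction.

(** * Row and column operations reducing M(0) *)

Definition row_op_mx (R : comNzRingType) (u : nat -> nat -> R) (a b : nat) : R :=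
  if a == b then 1 else if (a < b)%N then u a (b - a.+1)%N else 0.

Definition col_op_mx (R : comNzRingType) (v : nat -> nat -> R) (b c : nat) : R :=
  if b == c then 1 else if (b < c)%N then v c b else 0.

Lemma row_op_mx_unitri (R : comNzRingType) (u : nat -> nat -> R) :
  upper_unitri (row_op_mx u).
Proof.
split=> [a|a b lt]; first by rewrite /row_op_mx eqxx.
by rewrite /row_op_mx gtn_eqF // ltnNge ltnW.
Qed.

Lemma col_op_mx_unitri (R : comNzRingType) (v : nat -> nat -> R) :
  upper_unitri (col_op_mx v).
Proof.
split=> [a|a b lt]; first by rewrite /col_op_mx eqxx.
by rewrite /col_op_mx gtn_eqF // ltnNge ltnW.
Qed.

Section Sandwich.
Variables (R : comNzRingType) (n : nat) (u v G : nat -> nat -> R).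

Let S := sandwich n (row_op_mx u) (col_op_mx v) G.

Lemma sandwich_rows a c : (a < n)%N -> (c < n)%N ->
  S a c = (G a c + \sum_(r < n - a.+1) u a r * G (a.+1 + r)%N c) +
    \sum_(b < c) (G a b + \sum_(r < n - a.+1) u a r * G (a.+1 + r)%N b) * v c b.
Proof.
move=> lta ltc; rewrite /S /sandwich exchange_big /=.
under eq_bigr do rewrite -mulr_suml.
rewrite (@sum_col_op _ n c (v c) (fun b' => \sum_(b < n) row_op_mx u a b * G b b')) //.
rewrite (@sum_row_op _ n a (u a) (fun b => G b c)) //; congr (_ + _).
apply: eq_bigr => b _; congr (_ * _).
by rewrite (@sum_row_op _ n a (u a) (fun b' => G b' b)).
Qed.

Lemma sandwich_cols a c : (c < n)%N ->
  S a c = \sum_(b < n) row_op_mx u a b * (G b c + \sum_(b' < c) G b b' * v c b').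
Proof.
move=> ltc; apply: eq_bigr => b _.
under eq_bigr do rewrite -mulrA.
by rewrite -mulr_sumr (@sum_col_op _ n c (v c) (fun b' => G b b')).
Qed.

End Sandwich.

Section Reduction.
Variables (F : fieldType) (m n : nat) (x : 'M[F]_(m, n)).
Hypothesis m_gt0 : (0 < m)%N.
Hypothesis n_gt0 : (0 < n)%N.
Hypothesis shape_inv_neq0 : forall j, (1 <= j <= minn m n)%N -> shape_inv x j != 0.

Local Notation g := (folded_coef x).
Local Notation corner s := (sqdet (n - s)%N (fun r c => g 0%N (s + r)%N c)).

Let corner_neq0 s : (s <= minn m n)%N -> corner s != 0.
Proof.
move=> le; rewrite -shape_inv_sqdet //; case: (ltnP s (minn m n)) => h.
  exact: shape_inv_neq0.
by rewrite /shape_inv /= ltnNge h /= oner_neq0.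
Qed.

(** For [a < m] the truncated difference is 0 and the system is a corner, whose determinant is a
    shape invariant; row [a] is cleared left of the antidiagonal. For [m <= a] the system is
    unitriangular, and clearing starts just right of the 1 in column [a - m]. *)
Lemma row_ops_exist : exists u : nat -> nat -> F, forall a, (a < n)%N ->
  forall c, (c < n - a.+1)%N ->
  g 0 a (a.+1 - m + c)%N +
  \sum_(r < n - a.+1) u a r * g 0 (a.+1 + r)%N (a.+1 - m + c)%N = 0.
Proof.
suff /choice[u hu] : forall a, exists w : nat -> F, (a < n)%N ->
    forall c, (c < n - a.+1)%N ->
    g 0 a (a.+1 - m + c)%N +
    \sum_(r < n - a.+1) w r * g 0 (a.+1 + r)%N (a.+1 - m + c)%N = 0.
  by exists u.
move=> a; case: (ltnP a n) => lta; last by exists (fun=> 0).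
have [|w hw] := @left_solve F (n - a.+1) (fun r c => g 0 (a.+1 + r)%N (a.+1 - m + c)%N)
    (fun c => g 0 a (a.+1 - m + c)%N); last by exists w.
case: (ltnP a m) => ltm.
  have -> : (a.+1 - m = 0)%N by lia.
  by apply: corner_neq0; lia.
rewrite sqdet_upper_unitriangular ?oner_neq0 // => [i lt|i j /andP[lt _]].
  by rewrite folded_coef_const entry_low //; lia.
by rewrite folded_coef_const entry_lt //; lia.
Qed.

(** Clearing below the antidiagonal concerns only columns [c] with [n - m <= c]. The columns before
    them must stay as they are: the row operations already give them the entries 1 of M'. *)
Lemma col_ops_exist : exists v : nat -> nat -> F, forall c, (c < n)%N ->
  if (n - m <= c)%N then forall r, (r < c)%N ->
    g 0 (n - c + r)%N c + \sum_(b < c) g 0 (n - c + r)%N b * v c b = 0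
  else forall b, v c b = 0.
Proof.
suff /choice[v hv] : forall c, exists w : nat -> F, (c < n)%N ->
    if (n - m <= c)%N then forall r, (r < c)%N ->
      g 0 (n - c + r)%N c + \sum_(b < c) g 0 (n - c + r)%N b * w b = 0
    else forall b, w b = 0.
  by exists v.
move=> c; case: (ltnP c n) => ltc; last by exists (fun=> 0).
case: leqP => lem; last by exists (fun=> 0).
have [|w hw] := @right_solve F c (fun r b => g 0 (n - c + r)%N b)
    (fun r => g 0 (n - c + r)%N c); last by exists w.
have := @corner_neq0 (n - c) _; rewrite subKn ?(ltnW ltc) //; apply; lia.
Qed.

Variables (u v : nat -> nat -> F).
Hypothesis rowE : forall a, (a < n)%N -> forall c, (c < n - a.+1)%N ->
  g 0 a (a.+1 - m + c)%N +
  \sum_(r < n - a.+1) u a r * g 0 (a.+1 + r)%N (a.+1 - m + c)%N = 0.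
Hypothesis colE : forall c, (c < n)%N ->
  if (n - m <= c)%N then forall r, (r < c)%N ->
    g 0 (n - c + r)%N c + \sum_(b < c) g 0 (n - c + r)%N b * v c b = 0
  else forall b, v c b = 0.

Local Notation M d := (sandwich n (row_op_mx u) (col_op_mx v) (g d)).
Local Notation row_op d a c :=
  (g d a c + \sum_(r < n - a.+1) u a r * g d (a.+1 + r)%N c).

Let row_op_zero a c : (a < n)%N -> (a < m)%N -> (c < n - a.+1)%N -> row_op 0%N a c = 0.
Proof.
move=> lta ltm ltc; have := rowE lta ltc.
by have -> : (a.+1 - m + c = c)%N by lia.
Qed.

Let row_op_low a c : (a < n)%N -> (m <= a)%N -> (c < n - m)%N ->
  row_op 0%N a c = (a == (m + c)%N)%:R.
Proof.
move=> lta lem ltc; case: (ltngtP a (m + c)%N) => h.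
- have h' : (c - (a.+1 - m) < n - a.+1)%N by lia.
  have := rowE lta h'.
  by have -> : (a.+1 - m + (c - (a.+1 - m)) = c)%N by lia.
- rewrite folded_coef_const entry_lt //; last by lia.
  rewrite big1 ?addr0 // => r _; rewrite folded_coef_const entry_lt ?mulr0 //; lia.
rewrite folded_coef_const entry_low //; last by lia.
by rewrite big1 ?addr0 // => r _; rewrite folded_coef_const entry_lt ?mulr0 //; lia.
Qed.

Let M0_left a c : (a < n)%N -> (a < m)%N -> (c < n - a.+1)%N -> M 0%N a c = 0.
Proof.
move=> lta ltm ltc; rewrite sandwich_rows //; last by lia.
rewrite row_op_zero // add0r big1 // => b _.
by rewrite row_op_zero ?mul0r // (ltn_trans (ltn_ord b)).
Qed.

Let M0_right a c : (c < n)%N -> (n - m <= c)%N -> (n <= a + c)%N -> (a < n)%N ->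
  M 0%N a c = 0.
Proof.
move=> ltc lem le lta; rewrite sandwich_cols //; apply: big1 => b _.
case: (ltnP b a) => ltb.
  by rewrite (row_op_mx_unitri u).2 ?mul0r.
have := colE ltc; rewrite lem => h.
have h' : (b - (n - c) < c)%N by have := ltn_ord b; lia.
have := h _ h'; have -> : (n - c + (b - (n - c)) = b)%N by lia.
by move=> ->; rewrite mulr0.
Qed.

(** Two nested corners are unchanged by the reduction, and the first row of the larger one retains
    only its antidiagonal entry; their ratio is that entry up to sign. *)
Let M0_antidiag a c : (a + c).+1 = n -> (a < m)%N ->
  M 0%N a c = (-1) ^+ c * (shape_inv x a.+1 / shape_inv x a.+2).
Proof.
move=> eac ltm.
have les : (a.+1 <= minn m n)%N by lia.
have lea : (a <= minn m n)%N by lia.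
have cornerE s : (s <= n)%N -> corner s = sqdet (n - s)%N (fun r c => M 0%N (s + r)%N c).
  move=> le; rewrite sqdet_sandwich ?subnKC //.
    exact: row_op_mx_unitri.
  exact: col_op_mx_unitri.
have nz : shape_inv x a.+2 != 0 by rewrite shape_inv_sqdet // corner_neq0.
apply: (mulIf nz); rewrite -mulrA divfK // !shape_inv_sqdet // !cornerE; try lia.
have -> : (n - a = c.+1)%N by lia.
have -> : (n - a.+1 = c)%N by lia.
rewrite /sqdet (expand_det_row _ ord0) (bigD1 ord_max) //= [X in _ + X]big1.
  rewrite addr0 mxE addn0 /cofactor add0n mulrCA signrMK; congr (_ * \det _).
  by apply/matrixP => i j; rewrite !mxE lift0 lift_max addSnnS.
move=> i; rewrite -val_eqE /= => nei; rewrite mxE addn0 M0_left ?mul0r //.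
  by lia.
by have := ltn_ord i; lia.
Qed.

Lemma sandwich_const a c : (a < n)%N -> (c < n)%N ->
  M 0%N a c = Mprime x a.+1 c.+1.
Proof.
move=> lta ltc; rewrite /Mprime.
have anti : (a.+1 + c.+1 == n + 1)%N = ((a + c).+1 == n) by lia.
rewrite anti; case: (leqP (n - m) c) => lem; last first.
  have -> : (a.+1 <= m)%N && ((a + c).+1 == n) = false by lia.
  have := colE ltc; rewrite leqNgt lem /= => v0.
  rewrite sandwich_rows // [X in _ + X]big1 ?addr0 => [|b _]; last by rewrite v0 mulr0.
  case: (ltnP a m) => h.
    by rewrite row_op_zero //; [case: eqP => //; lia|lia].
  rewrite row_op_low // addnS eqSS; by case: eqP.
have -> : (a.+1 == m + c.+1)%N = false by lia.
case: (ltngtP (a + c).+1 n) => h; rewrite ?andbF.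
- by rewrite M0_left //; lia.
- by rewrite M0_right //; lia.
rewrite andbT; have ltm : (a < m)%N by lia.
rewrite ltm M0_antidiag // addn1; congr (_ ^+ _ * _); lia.
Qed.

Let sandwich_zero d a c : (m + c)%N%:Z < a%:Z + (n * d)%N%:Z -> M d a c = 0.
Proof.
rewrite PoszM => lt; apply: big1 => b _; apply: big1 => b' _.
case: (ltnP b a) => h; first by rewrite (row_op_mx_unitri u).2 ?mul0r.
case: (ltnP c b') => h'; first by rewrite (col_op_mx_unitri v).2 ?mulr0.
rewrite /folded_coef entry_lt ?mulr0 ?mul0r //.
by lia.
Qed.

Let sandwich_one d a c : (a < n)%N -> (c < n)%N ->
  (m + c)%N%:Z = a%:Z + (n * d)%N%:Z -> M d a c = 1.
Proof.
move=> lta ltc; rewrite PoszM => e; rewrite sandwich_rows // /folded_coef.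
rewrite entry_low; last by lia.
rewrite big1 ?addr0 => [|r _]; last by rewrite entry_lt ?mulr0 //; lia.
rewrite big1 ?addr0 // => b _; have ltb := ltn_ord b.
rewrite entry_lt; last by lia.
rewrite big1 ?addr0 ?mul0r // => r _; rewrite entry_lt ?mulr0 //; lia.
Qed.

Let sandwich_pos d a c h : (a < n)%N -> (c < n)%N -> (0 < d)%N -> (0 < h)%N ->
  h%:Z = (m + c)%N%:Z - a%:Z - (n * d)%N%:Z -> M d a c = redQ_pos x h a.+1.
Proof.
move=> lta ltc d_gt0 h_gt0 eh.
have leND : (n <= n * d)%N by rewrite leq_pmulr.
have ltm : (a < m)%N by lia.
have lem : (n - m <= c)%N by lia.
have eND : n%:Z * d%:Z = (n * d)%N%:Z by rewrite PoszM.
rewrite (redQ_pos_sqdet x m_gt0 n_gt0 lta ltc d_gt0 h_gt0 eh).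
have [l el] : exists l, l = (n - a.+1)%N by exists (n - a.+1)%N.
pose A : 'M[F]_c := \matrix_(i, j) g 0 (n - c + i)%N j.
pose al : 'cV[F]_c := \col_i g 0 (n - c + i)%N c.
pose gr : 'rV[F]_c := \row_j g d a j.
pose C : 'M[F]_(l, c) := \matrix_(i, j) g d (a.+1 + i)%N j.
pose e : 'M[F]_1 := (g d a c)%:M.
pose rh : 'rV[F]_l := \row_j g 0 a j.
pose ga : 'cV[F]_l := \col_i g d (a.+1 + i)%N c.
pose D : 'M[F]_l := \matrix_(i, j) g 0 (a.+1 + i)%N j.
pose u' : 'rV[F]_l := \row_r u a r.
pose v' : 'cV[F]_c := \col_b v c b.
have hv : al + A *m v' = 0.
  apply/matrixP => i j; rewrite !mxE; have := colE ltc; rewrite lem => H.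
  by rewrite -[RHS](H i (ltn_ord i)); congr (_ + _); apply: eq_bigr => b _; rewrite !mxE.
have hu : rh + u' *m D = 0.
  apply/matrixP => i j; rewrite !mxE; have ltj := ltn_ord j.
  rewrite -[RHS](@row_op_zero a j) //; last by rewrite -el.
  by rewrite -el; congr (_ + _); apply: eq_bigr => b _; rewrite !mxE.
(* Entries with both row and column shifted by [n * d] are constant coefficients by periodicity,
   those with only the column shifted have degree [d], and those with only the row shifted lie
   outside the band. *)
have -> : sqdet (c + (1 + (n - a.+1)))%N (bordered_entry x a c d) =
    \det (block_mx A (row_mx al 0) (col_mx gr C) (block_mx e rh ga D)).
  rewrite -el /sqdet; congr (\det _).
  rewrite -[LHS]submxK; congr block_mx.
  - apply/matrixP => i j; rewrite !mxE /= /bordered_entry ltn_ord (ltnW (ltn_ord j)).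
    rewrite folded_coef_const -[RHS](entry_period x m _ _ (- d%:Z)); congr (entry _ _ _ _); ring.
  - rewrite -[LHS]hsubmxK; congr row_mx; apply/matrixP => i j; rewrite !mxE /= /bordered_entry ltn_ord.
      rewrite ord1 addn0 leqnn.
      rewrite folded_coef_const -[RHS](entry_period x m _ _ (- d%:Z)); congr (entry _ _ _ _); ring.
    have -> : (c + (1 + j) <= c)%N = false by lia.
    by rewrite entry_gt //; have := ltn_ord i; lia.
  - rewrite -[LHS]vsubmxK; congr col_mx; apply/matrixP => i j; rewrite !mxE /= /bordered_entry (ltnW (ltn_ord j)).
      by rewrite ord1 addn0 ltnn subnn addn0.
    have -> : (c + (1 + i) < c)%N = false by lia.
    by congr (entry _ _ _ _); lia.
  rewrite -[LHS]submxK; congr block_mx; apply/matrixP => i j; rewrite !mxE /= /bordered_entry.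
  - by rewrite !ord1 addn0 ltnn leqnn subnn addn0 eqxx mulr1n.
  - rewrite ord1 addn0 ltnn subnn addn0 folded_coef_const.
    have -> : (c + (1 + j) <= c)%N = false by lia.
    by congr (entry _ _ _ _); lia.
  - rewrite ord1 addn0 leqnn; have -> : (c + (1 + i) < c)%N = false by lia.
    by congr (entry _ _ _ _); lia.
  have -> : (c + (1 + i) < c)%N = false by lia.
  have -> : (c + (1 + j) <= c)%N = false by lia.
  by rewrite folded_coef_const; congr (entry _ _ _ _); lia.
rewrite (det_bordered _ _ _ _ hv hu).
have dA : \det A = shape_inv x (n + 1 - c)%N.
  have -> : (n + 1 - c = (n - c).+1)%N by lia.
  rewrite shape_inv_sqdet //; last by lia.
  by rewrite /sqdet subKn // ltnW.
have dD : \det D = shape_inv x (a.+1 + 1)%N.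
  by rewrite addn1 shape_inv_sqdet //; [rewrite -el|lia].
rewrite -dA -dD; have nzA : \det A != 0.
  rewrite dA; have -> : (n + 1 - c = (n - c).+1)%N by lia.
  by rewrite shape_inv_sqdet // ?corner_neq0 //; lia.
have nzD : \det D != 0.
  by rewrite dD addn1 shape_inv_sqdet // ?corner_neq0 //; lia.
rewrite [X in X / _]mulrAC [X in X / _]mulrC [_ * \det A]mulrC mulfK ?mulf_neq0 //.
rewrite sandwich_rows // !mxE /= ?eqxx ?mulr1n -el; congr (_ + _ + _).
  by apply: eq_bigr => r _; rewrite !mxE.
apply: eq_bigr => b _; rewrite !mxE; congr ((_ + _) * _).
by apply: eq_bigr => r _; rewrite !mxE.
Qed.

Lemma sandwich_redQ d a c : (a < n)%N -> (c < n)%N -> (0 < d)%N ->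
  M d a c = redQ x ((m + c.+1)%N%:Z - a.+1%:Z - (n * d)%N%:Z) a.+1.
Proof.
move=> lta ltc d_gt0.
have : (m + c.+1)%N%:Z - a.+1%:Z - (n * d)%N%:Z =
  (m + c)%N%:Z - a%:Z - (n * d)%N%:Z by lia.
case: (_ - _ - _) => [[|h]|h] e; rewrite /redQ.
- by apply: sandwich_one => //; lia.
- by apply: sandwich_pos.
by apply: sandwich_zero; lia.
Qed.

End Reduction.

(** * The minor of the theorem *)

Lemma minor_sqdet (R : comNzRingType) n k s (A B : {set 'I_n}) (f : nat -> nat -> R) :
  [seq val a | a <- enum A] = iota s k -> [seq val b | b <- enum B] = iota 0 k ->
  minor A B (\matrix_(a, b) f a b) = sqdet k (fun r c => f (s + r)%N c).
Proof.
move=> eA eB.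
have cA : #|A| = k by rewrite cardE -(size_map val) eA size_iota.
have sA : size (enum A) = k by rewrite -cardE.
have sB : size (enum B) = k by rewrite -(size_map val) eB size_iota.
transitivity (sqdet #|A| (fun r c => f (s + r)%N c)); last exact: eq_sqdet.
congr (\det _); apply/matrixP => a b; rewrite !mxE.
have lta : (a < k)%N by rewrite -cA.
have ltb : (b < k)%N by rewrite -cA.
congr f.
  rewrite (enum_val_nth (enum_val a)) -[LHS](nth_map _ 0%N val) ?eA ?nth_iota //.
  by rewrite sA.
by rewrite -[LHS](nth_map _ 0%N val) ?sB // eB nth_iota.
Qed.

Lemma enum_ord_filter n (p : pred nat) :
  [seq val a | a <- enum [set a : 'I_n | p a]] = [seq a <- iota 0 n | p a].
Proof.
rewrite -val_enum_ord filter_map; congr map.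
rewrite {1}/enum_mem -enumT; apply: eq_filter => a; exact: in_set.
Qed.

Section Final.
Variables (F : fieldType) (m n : nat) (x : 'M[F]_(m, n)).
Hypothesis m_gt0 : (0 < m)%N.
Hypothesis n_gt0 : (0 < n)%N.
Hypothesis shape_inv_neq0 : forall j, (1 <= j <= minn m n)%N -> shape_inv x j != 0.

Lemma coef_Mhat_entry i j e : (0 < i)%N -> (j <= n)%N ->
  (Mhat_entry x i j)`_e =
  if e == 0%N then Mprime x i j
  else redQ x ((m + j)%N%:Z - i%:Z - (n * e)%N%:Z) i.
Proof.
move=> i0 lej; rewrite /Mhat_entry coefD coefC coef_sum.
case: eqP => [->|/eqP e0].
  rewrite big_nat_cond big1 ?addr0 // => d /andP[/andP[d0 _] _].
  by rewrite coefZ coefXn eq_sym gtn_eqF ?mulr0.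
rewrite add0r; under eq_bigr do rewrite coefZ coefXn mulr_natr mulrb eq_sym.
rewrite -big_mkcond /=; case: (leqP e (m + n)) => le.
  rewrite (big_nat_widen _ _ (m + n).+1) // -big_nat_widen //.
  rewrite big_nat1_eq.
  by have -> : (0 < e < (m + n).+1)%N by lia.
rewrite big_nat_cond big_pred0 => [|d]; last by lia.
have : (m + j)%N%:Z - i%:Z - (n * e)%N%:Z < 0.
  have : (e <= n * e)%N by rewrite leq_pmull.
  by lia.
by case: (_ - _ - _).
Qed.

Lemma Mhat_entry_sandwich : exists U V : nat -> nat -> {poly F},
  [/\ upper_unitri U, upper_unitri V & forall a c, (a < n)%N -> (c < n)%N ->
   Mhat_entry x a.+1 c.+1 =
   sandwich n U V (fun a c => folded x m a.+1%:Z c.+1%:Z) a c].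
Proof.
have [u rowE] := row_ops_exist m_gt0 n_gt0 shape_inv_neq0.
have [v colE] := col_ops_exist m_gt0 n_gt0 shape_inv_neq0.
have polyC_unitri (U : nat -> nat -> F) : upper_unitri U ->
    upper_unitri (fun a b => (U a b)%:P).
  by move=> [U1 U0]; split=> [a|a b lt]; rewrite ?U1 ?U0.
exists (fun a b => (row_op_mx u a b)%:P), (fun b c => (col_op_mx v b c)%:P).
split.
- exact/polyC_unitri/row_op_mx_unitri.
- exact/polyC_unitri/col_op_mx_unitri.
move=> a c lta ltc; apply/polyP => e; rewrite coef_Mhat_entry //.
transitivity (sandwich n (row_op_mx u) (col_op_mx v) (folded_coef x e) a c).
  case: eqP => [->|/eqP e0]; first by rewrite sandwich_const.
  by rewrite sandwich_redQ // lt0n.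
rewrite coef_sum; apply: eq_bigr => b _; rewrite coef_sum; apply: eq_bigr => b' _.
by rewrite coefMC coefCM coef_folded //; have := ltn_ord b; lia.
Qed.

Lemma minor_Mhat i : (0 < i)%N -> (i <= n)%N ->
  minor [set a : 'I_n | (i <= a.+1)%N] [set b : 'I_n | (b.+1 <= n - i + 1)%N]
    (Mhat x) =
  fdet x (fun c : 'I_(n - i).+1 => (n - i).+1%:Z - c%:Z).
Proof.
move=> i_gt0 i_len.
rewrite (@minor_sqdet _ n (n - i).+1 i.-1 _ _ (fun a c => Mhat_entry x a.+1 c.+1)).
- have [U [V [hU hV E]]] := Mhat_entry_sandwich.
  transitivity (sqdet (n - i).+1 (fun r c => sandwich n U V
     (fun a c => folded x m a.+1%:Z c.+1%:Z) (i.-1 + r)%N c)).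
    by apply: eq_sqdet => // r c ltr ltc; apply: E; lia.
  rewrite sqdet_sandwich //; last by lia.
  rewrite sqdet_rev /sqdet -det_tr /fdet; congr (\det _).
  apply/matrixP => c r; rewrite !mxE; congr (folded _ _ _ _).
    by have := ltn_ord r; lia.
  by have := ltn_ord c; lia.
- rewrite (enum_ord_filter n (fun a => i <= a.+1)%N).
  have -> : iota 0 n = iota 0 i.-1 ++ iota i.-1 (n - i).+1.
    by rewrite -(iotaD 0); congr iota; lia.
  rewrite filter_cat.
  rewrite (eq_in_filter (a2 := pred0)) => [|a]; last by rewrite mem_iota /=; lia.
  rewrite filter_pred0 cat0s; apply/all_filterP/allP => a.
  by rewrite mem_iota; lia.
rewrite (enum_ord_filter n (fun b => b.+1 <= n - i + 1)%N).
have -> : iota 0 n = iota 0 (n - i).+1 ++ iota (n - i).+1 i.-1.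
  by rewrite -(iotaD 0); congr iota; lia.
rewrite filter_cat [X in _ ++ X](eq_in_filter (a2 := pred0)) => [|a]; last first.
  by rewrite mem_iota /=; lia.
rewrite filter_pred0 cats0; apply/all_filterP/allP => a.
by rewrite mem_iota; lia.
Qed.

End Final.

(** * Nonvanishing of the shape invariants *)

Section Nonvanishing.
Variables (R : realType) (m n : nat).
Hypothesis n_gt0 : (0 < n)%N.

Let poly_var (i : 'I_m) (r : int) : {mpoly R[i][m * n]} :=
  if [pick j : 'I_n | (j.+1%:Z == r - i.+1%:Z + 1 %[mod n%:Z])%Z] is Some j
  then 'X_(mxvec_index i j) else 0.

Let tofrac_poly_var i r : tofrac (poly_var i r) = loop_var (indets R m n) i r.
Proof.
rewrite /poly_var /loop_var; case: pickP => [j _|_]; last by rewrite rmorph0.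
by rewrite mxE.
Qed.

Let meval_poly_var i r : (poly_var i r).@[fun=> 1] = 1.
Proof.
rewrite /poly_var; case: pickP => [j _|none]; first by rewrite mevalXU.
have n0 : n%:Z != 0 by lia.
have ge0 := modz_ge0 (r - i.+1%:Z) n0.
have lt : (`|((r - i.+1%:Z) %% n%:Z)%Z| < n)%N.
  by rewrite -ltz_nat gez0_abs // ltz_pmod //; lia.
have := none (Ordinal lt).
by rewrite /= -addn1 PoszD gez0_abs // modzDml eqxx.
Qed.

(** Setting all variables to 1 counts the tableaux, and a positive count is nonzero in
    characteristic 0. Evaluation takes place on a polynomial preimage. *)
Lemma loop_schur_indets_neq0 r (sh : skew_shape) (T0 : filling sh m) :
  semistandard T0 -> loop_schur (indets R m n) r sh != 0.
Proof.
move=> ss.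
pose p := \sum_(T : filling sh m | semistandard T)
  \prod_(s : cell sh) poly_var (T s) (content s + r).
have -> : loop_schur (indets R m n) r sh = tofrac p.
  rewrite rmorph_sum; apply: eq_bigr => T _.
  by rewrite rmorph_prod; apply: eq_bigr => s _; rewrite -tofrac_poly_var.
rewrite tofrac_eq0; apply/eqP => p0.
have : p.@[fun=> 1] = 0 by rewrite p0 meval0.
rewrite /p rmorph_sum (eq_bigr (fun=> 1)) => [|T _]; last first.
  by rewrite rmorph_prod big1 // => s _; exact: meval_poly_var.
rewrite sumr_const => /eqP; rewrite pnatr_eq0; apply/negP; rewrite -lt0n.
by apply/card_gt0P; exists T0.
Qed.

Lemma shape_inv_indets_neq0 j : (1 <= j <= minn m n)%N ->
  shape_inv (indets R m n) j != 0.
Proof.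
move=> hj; rewrite /shape_inv hj; set sh := (_, _).
have m_gt0 : (0 < m)%N by lia.
have lt (s : cell sh) : (0 < cell_row s <= m)%N.
  have : val s \in skew_cells sh by apply: ssvalP.
  case/allpairsPdep => a [b [+ _ e]]; rewrite /cell_row e /= mem_iota size_nseq.
  by lia.
(* The witness fills each cell with its row number. *)
apply: (@loop_schur_indets_neq0 _ _ [ffun s => insubd (Ordinal m_gt0) (cell_row s).-1]).
have TE (s : cell sh) : insubd (Ordinal m_gt0) (cell_row s).-1 = (cell_row s).-1 :> nat.
  by rewrite val_insubd ifT //; have := lt s; lia.
apply/forallP => s; apply/forallP => s'; rewrite !ffunE !TE.
have h1 := lt s; have h2 := lt s'.
by apply/andP; split; apply/implyP => /andP[/eqP e h]; lia.
Qed.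

End Nonvanishing.

Theorem theorem6p10 (R : realType) (m n i : nat)
    (hm : (1 <= m)%N) (hn : (1 <= n)%N)
    (hi : (1 <= i <= minn m n + 1)%N) (hin : (i <= n)%N) :
  let k := (n - i + 1)%N in
  let nu := nseq (m + 1 - i) k in
  minor [set a : 'I_n | (i <= a.+1)%N] [set b : 'I_n | (b.+1 <= k)%N]
        (Mhat (indets R m n))
  = \sum_(0 <= d < (m + 2 - 2 * i).+1)
      ((-1) ^+ (n - i) *: 'X) ^+ d *
      (cyl_loop_schur_opt (indets R m n) k n%:Z
         (removal_iter n k d (nu, [::])))%:P.
Proof.
have /andP[i_gt0 i_le] := hi; have i_lem : (i <= m + 1)%N by lia.
move=> k nu; rewrite minor_Mhat //; last exact: shape_inv_indets_neq0.
by rewrite /nu /k (addn1 (n - i)); apply: fdet_expansion.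
Qed.
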